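(* Let $\rho\in(0,1]$ and $\alpha\in(0,1]$. The density of the $\Gamma$-grey Brownian motion $B_{\alpha,\rho}$, $$f_{B_{\alpha,\rho}}(x,t)=\frac{1}{\sqrt{2\pi t^\alpha}}\int_0^{+\infty}\tau^{-1/2}\exp\left\{-\frac{x^2}{2\tau t^\alpha}\right\}l_\rho(\tau)\,d\tau,\qquad x\in\mathbb{R},\ t\ge 0,$$ satisfies the following integro-differential equation $$\frac{\partial}{\partial t}f(x,t)=\frac{\alpha\rho}{t}\bigl[f(x,t)-f(x,0)\bigr]+\frac{\alpha}{2t}\frac{\partial^2}{\partial x^2}\int_0^t z^\alpha\frac{\partial}{\partial z}f(x,z)\,dz,$$ with initial conditions $f(x,0)=\delta(x)$ and $f(0,t)=0$, where $\delta$ is the Dirac delta at $0$.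
   Context: $B_{\alpha,\rho}$ is the process with one-dimensional characteristic function $\mathbb{E}e^{i\xi B_{\alpha,\rho}(t)}=\Gamma(\rho,\xi^2t^\alpha/2)/\Gamma(\rho)$, $\xi\in\mathbb{R}$, where $\Gamma(\rho,x):=\int_x^{+\infty}e^{-w}w^{\rho-1}\,dw$ is the upper incomplete gamma function. In one-dimensional distribution it equals $\sqrt{Y_\rho}\,B^{\alpha/2}(t)$, with $B^{\alpha/2}$ a fractional Brownian motion with Hurst parameter $\alpha/2$ (with $B^{\alpha/2}(t)$ centered Gaussian of variance $t^\alpha$) and $Y_\rho$ an independent random variable with density $l_\rho$. Here $l_\rho(y)=\frac{1}{\Gamma(\rho)\Gamma(1-\rho)}\frac{1}{y(y-1)^\rho}1_{y>1}$ for $\rho\in(0,1)$; for $\rho=1$, $l_1(\tau)\,d\tau$ is understood as the Dirac mass at $\tau=1$.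
   Formalization: The condition f(0,t)=0 is false (for ρ=1, f(0,t)=(2πt^α)^{-1/2}>0) and is replaced by f(x,t)→0 as x→±∞ for each t>0; the equation is read for t>0 in the sense of distributions in x, and f(x,0)=δ(x) as the limit t→0+. *)

(* Defs.v *)
From HB Require Import structures.
From mathcomp Require Import all_boot all_order all_algebra.
From mathcomp Require Import all_classical all_reals all_analysis.
Import Order.TTheory GRing.Theory Num.Theory.
Import numFieldNormedType.Exports.

Set Implicit Arguments.
Unset Strict Implicit.
Unset Printing Implicit Defensive.

Local Open Scope classical_set_scope.
Local Open Scope ring_scope.

Definition Gamma (R : realType) (a : R) : R :=
  \int[lebesgue_measure]_(w in `]0, +oo[) (expR (- w) * w `^ (a - 1)).

(* For rho = 1 the factor Gamma (1 - rho) diverges and this formula is not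
   used: see lmix. *)
Definition lrho (R : realType) (rho y : R) : R :=
  if 1 < y then (Gamma rho * Gamma (1 - rho))^-1 * (y * (y - 1) `^ rho)^-1
  else 0.

(* Integral over ]0, +oo[ of h(tau) against l_rho(tau) dtau, which for rho = 1
   stands for the Dirac mass at 1. *)
Definition lmix (R : realType) (rho : R) (h : R -> R) : R :=
  if rho == 1 then \int[\d_(1 : R)]_(tau in `]0, +oo[) h tau
  else \int[lebesgue_measure]_(tau in `]0, +oo[) (h tau * lrho rho tau).

(* Meaningful for 0 < t only; at t = 0 the law of the process is the Dirac
   mass at 0, which has no density. *)
Definition fB (R : realType) (alpha rho x t : R) : R :=
  (Num.sqrt (2 * pi * t `^ alpha))^-1 *
  lmix rho (fun tau =>
    tau `^ (- 2^-1) * expR (- (x ^+ 2 / (2 * tau * t `^ alpha)))).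

(* Distributions on the real line, as functionals; they are only ever
   evaluated at, and compared on, test functions. *)
Definition distribution_on (R : realType) := (R -> R) -> R.

Definition test_function (R : realType) (phi : R -> R) : Prop :=
  (forall (n : nat) (x : R), derivable (phi^`(n))%classic x 1) /\
  exists M : R, forall x : R, M < `|x| -> phi x = 0.

(* Represents g as a distribution when g is locally integrable. *)
Definition regular (R : realType) (g : R -> R) : distribution_on R :=
  fun phi => \int[lebesgue_measure]_x (g x * phi x).

Definition delta (R : realType) (a : R) : distribution_on R := fun phi => phi a.

Definition ddist (R : realType) (T : distribution_on R) : distribution_on R :=
  fun phi => - T (phi^`())%classic.

Definition dt (R : realType) (f : R -> R -> R) (x t : R) : R :=
  ((fun s => f x s)^`())%classic t.

Definition memory (R : realType) (alpha : R) (f : R -> R -> R) (x t : R) : R :=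
  \int[lebesgue_measure]_(z in `]0, t[) (z `^ alpha * dt f x z).

(* All the quantities in the equation exist: the t-derivative is classical at
   every x, the integral over ]0, t[ converges absolutely at every x, and the
   functions of x involved define distributions. *)
Definition terms_well_defined (R : realType) (alpha : R) (f : R -> R -> R) : Prop :=
  forall t : R, 0 < t ->
  [/\ forall x, derivable (fun s => f x s) t 1,
      forall x, lebesgue_measure.-integrable `]0, t[
                  (fun z => (z `^ alpha * dt f x z)%:E),
      locally_integrable setT (fun x => f x t),
      locally_integrable setT (fun x => dt f x t) &
      locally_integrable setT (fun x => memory alpha f x t)].

(* The equation at every time t > 0, as an identity between distributions in
   x; f0 is the initial datum f(., 0), itself a distribution. *)
Definition satisfies_equation (R : realType) (alpha rho : R)
    (f : R -> R -> R) (f0 : distribution_on R) : Prop :=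
  forall (t : R), 0 < t -> forall (phi : R -> R), test_function phi ->
    regular (fun x => dt f x t) phi =
      alpha * rho / t * (regular (fun x => f x t) phi - f0 phi) +
      alpha / (2 * t) * ddist (ddist (regular (fun x => memory alpha f x t))) phi.

Definition initial_datum (R : realType)
    (f : R -> R -> R) (f0 : distribution_on R) : Prop :=
  forall phi : R -> R, test_function phi ->
    regular (fun x => f x t) phi @[t --> 0^'+] --> f0 phi.

(* The boundary condition in space. The source prints f(0, t) = 0 instead,
   which fails for fB: fB alpha rho 0 t > 0 for every t > 0. *)
Definition vanishes_at_infinity (R : realType) (f : R -> R -> R) : Prop :=
  forall t : R, 0 < t ->
    f x t @[x --> +oo] --> (0 : R) /\ f x t @[x --> -oo] --> (0 : R).

(* Main.v *)
Require Import Defs.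
From HB Require Import structures.
From mathcomp Require Import all_boot all_order all_algebra.
From mathcomp Require Import all_classical all_reals all_analysis.
From mathcomp Require Import measurable_realfun ring lra.
Import Order.TTheory GRing.Theory Num.Theory.
Import numFieldNormedType.Exports.

(* Self-similarity reduces everything to one variable: with r = t^(alpha/2),
   f(x, t) = h(x/r)/r, where h is a mixture of centred Gaussian densities.
   Integrating d/dtau (-2 tau^(-3/2) (tau - 1)^(1 - rho) exp (-b/tau)) over
   tau > 1 gives Kummer's equation for the mixture, that is
     y h'' + (2 + y^2) h' + (1 + 2 rho) y h = 0.
   Put k = (y h)', let Phi be the primitive of h vanishing at 0 and, on the
   half-line y >= 0, D = rho - y h - 2 rho Phi and m = y D - k. The equation
   says exactly m' = D, and D' = - (k + 2 rho h); hence
   d/dr (r m(x/r)) = - k(x/r), and the memory integral at (x, t) equals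
   r m(|x|/r). As m'(0+) = rho, the even extension of m has a corner at 0 whose
   slope jumps by 2 rho: this jump produces the Dirac mass in the equation.
   That Phi tends to 1/2, i.e. that the mixing density has integral 1, is the
   beta integral Gamma(rho) Gamma(1 - rho), by Tonelli. *)

Set Implicit Arguments.
Unset Strict Implicit.
Unset Printing Implicit Defensive.

Local Open Scope classical_set_scope.
Local Open Scope ring_scope.

(** * Exhaustion by segments and the fundamental theorem of calculus *)

Local Notation mu := lebesgue_measure.

(** For [rho < 1] the profile is an integral over tau, for [rho = 1] a single Gaussian; the record
    [profile] isolates what the argument uses, so that equation, initial datum and decay are proved
    once for both. The form of D comes from the equation: D' = - ((y h)' + 2 rho h) forces D = c - y
    h - 2 rho Phi, and c is fixed at the far end. The memory integral starts at time 0, where r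
    m(x/r) has to vanish; this is m(y)/y -> 0 as y -> +oo, and since m/y = D - k/y with k bounded, D
    has to vanish at infinity. As y h -> 0 and Phi -> 1/2, that means c = rho. The same constant is
    then D(0), the slope of m at the corner, so the total mass of h decides the coefficient of the
    Dirac mass. Since m solves its equation on the half-line only, test functions are folded to
    psi(x) = phi(x) + phi(-x). Evenness gives psi'(0) = 0, which removes m(0) from the boundary
    terms and leaves D(0) psi(0) = 2 rho phi(0). Integrals are Lebesgue integrals on open sets where
    integrands may blow up at an end: Fatou on segments yields integrability of nonnegative
    derivatives, dominated convergence then yields the values. *)

Lemma segment_FTC2 (R : realType) (f F : R -> R) (a b : R) : a < b ->
  (forall x, a <= x <= b -> is_derive x 1 F (f x)) ->
  (forall x, a <= x <= b -> {for x, continuous f}) ->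
  (\int[mu]_(x in `[a, b]) (f x)%:E = (F b - F a)%:E)%E.
Proof.
move=> ab dF cf.
have cF x : a <= x <= b -> {for x, continuous F}.
  move=> xab; apply: differentiable_continuous; apply/derivable1_diffP.
  by have [] := dF x xab.
rewrite EFinB; apply: continuous_FTC2 => //.
- apply: continuous_in_subspaceT => x; rewrite inE/= in_itv/=; exact: cf.
- split.
  + move=> x /[!in_itv]/= /andP[ax xb].
    by have /dF[] : a <= x <= b by rewrite !ltW.
  + by apply: cvg_at_right_filter; apply: cF; rewrite lexx ltW.
  + by apply: cvg_at_left_filter; apply: cF; rewrite lexx ltW.
- move=> x /[!in_itv]/= /andP[ax xb].
  by rewrite derive1E; have /dF[_ ->] : a <= x <= b by rewrite !ltW.
Qed.

Lemma exhaustion_integral_cvg (R : realType) (f F : R -> R) (I : set R)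
    (u v : R^nat) (l : R) :
  (forall n, u n < v n) -> (forall n, `[u n, v n] `<=` I) ->
  (forall x, I x -> is_derive x 1 F (f x)) ->
  (forall x, I x -> {for x, continuous f}) ->
  F (v n) - F (u n) @[n --> \oo] --> l ->
  (\int[mu]_(x in I) ((f \_ `[u n, v n]) x)%:E @[n --> \oo] --> l%:E)%E.
Proof.
move=> uv uvI dF cf Fl.
rewrite [X in X @ _ --> _](_ : _ = (fun n => (F (v n) - F (u n))%:E)); last first.
  apply/funext => n.
  transitivity (\int[mu]_(x in I) ((EFin \o f) \_ `[u n, v n]) x)%E.
    by apply: eq_integral => x _; rewrite restrict_EFin.
  rewrite -integral_mkcondr setIidr//.
  apply: segment_FTC2 => // x xuv;
    [apply: dF|apply: cf]; by apply: (uvI n); rewrite /= in_itv.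
by apply: cvg_EFin => //; exact: nearW.
Qed.

Lemma exhaustion_pointwise (R : realType) (f : R -> R) (u v : R^nat) (x : R) :
  (\forall n \near \oo, u n <= x <= v n) ->
  (((f \_ `[u n, v n]) x)%:E @[n --> \oo] --> (f x)%:E)%E.
Proof.
move=> uvx; apply: cvg_near_cst; apply: filterS uvx => n xn.
by rewrite patchE mem_set//= in_itv.
Qed.

Lemma exhaustion_measurable (R : realType) (f : R -> R) (I : set R)
    (u v : R^nat) : measurable I -> measurable_fun I f ->
  forall n, measurable_fun I (f \_ `[u n, v n]).
Proof.
move=> mI mf n; apply/measurable_restrict => //.
by apply: measurable_funS mf.
Qed.

(** The truncations to the segments are dominated by |f|, so the segment integrals, already known to
    tend to [l], also tend to the integral over [I]. *)
Lemma open_FTC2 (R : realType) (f F : R -> R) (I : set R) (u v : R^nat) (l : R) :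
  open I ->
  (forall n, u n < v n) -> (forall n, `[u n, v n] `<=` I) ->
  (forall x, I x -> \forall n \near \oo, u n <= x <= v n) ->
  (forall x, I x -> is_derive x 1 F (f x)) ->
  (forall x, I x -> {for x, continuous f}) ->
  F (v n) - F (u n) @[n --> \oo] --> l ->
  mu.-integrable I (EFin \o f) ->
  (\int[mu]_(x in I) (f x)%:E = l%:E)%E.
Proof.
move=> oI uv uvI uvx dF cf Fl intf.
have mI : measurable I by exact: open_measurable.
have mf : measurable_fun I f by case/integrableP : intf => /measurable_EFinP.
have Il := exhaustion_integral_cvg uv uvI dF cf Fl.
have [|||||_ _ If] := @dominated_convergence _ _ _ (@mu R) I mI
  (fun n => EFin \o (f \_ `[u n, v n])) (EFin \o f) (abse \o (EFin \o f)).
- by move=> n; apply/measurable_EFinP; exact: exhaustion_measurable.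
- exact/measurable_EFinP.
- by apply/aeW => x Ix; apply: exhaustion_pointwise; exact: uvx.
- exact: integrable_abse.
- apply/aeW => x n Ix /=; rewrite lee_fin patchE; case: ifP => // _.
  by rewrite normr0.
- exact: (cvg_unique _ If Il).
Qed.

(** Fatou's lemma bounds the integral of [f] by the limit [l] of the segment integrals;
    nonnegativity makes this a bound on the integral of |f|. *)
Lemma ge0_open_FTC2_integrable (R : realType) (f F : R -> R) (I : set R)
    (u v : R^nat) (l : R) :
  open I -> (forall x, I x -> 0 <= f x) ->
  (forall n, u n < v n) -> (forall n, `[u n, v n] `<=` I) ->
  (forall x, I x -> \forall n \near \oo, u n <= x <= v n) ->
  (forall x, I x -> is_derive x 1 F (f x)) ->
  (forall x, I x -> {for x, continuous f}) ->
  F (v n) - F (u n) @[n --> \oo] --> l ->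
  mu.-integrable I (EFin \o f).
Proof.
move=> oI f0 uv uvI uvx dF cf Fl.
have mI : measurable I by exact: open_measurable.
have mf : measurable_fun I f.
  by apply: open_continuous_measurable_fun => // x /set_mem; exact: cf.
have Il := exhaustion_integral_cvg uv uvI dF cf Fl.
apply/integrableP; split; first exact/measurable_EFinP.
rewrite (@le_lt_trans _ _ l%:E) ?ltry//.
have fatou_f := @fatou _ _ _ (@mu R) I mI (fun n => EFin \o (f \_ `[u n, v n]))
  (fun n => (measurable_EFinP _ _).2 (exhaustion_measurable u v mI mf n)).
have f_lim : limn_einf (fun n => \int[mu]_(x in I) ((f \_ `[u n, v n]) x)%:E)%E =
    l%:E.
  rewrite is_cvg_limn_einfE; first exact/cvg_lim.
  by apply/cvg_ex; exists l%:E.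
rewrite -f_lim; apply: le_trans (fatou_f _); last first.
  by move=> n x Ix; rewrite lee_fin patchE; case: ifP => // _; exact: f0.
rewrite le_eqVlt; apply/orP; left; apply/eqP.
apply: eq_integral => x /set_mem Ix /=.
rewrite ger0_norm ?f0//; apply/esym.
have fx := @exhaustion_pointwise _ f u v x (uvx _ Ix).
rewrite is_cvg_limn_einfE; first exact/cvg_lim.
by apply/cvg_ex; exists (f x)%:E.
Qed.

Lemma open_dominated_integrable (R : realType) (I : set R) (f g : R -> R) :
  open I -> (forall x, I x -> {for x, continuous f}) ->
  (forall x, I x -> `|f x| <= g x) ->
  mu.-integrable I (EFin \o g) -> mu.-integrable I (EFin \o f).
Proof.
move=> oI cf fg; apply: le_integrable.
- exact: open_measurable.
- apply/measurable_EFinP; apply: open_continuous_measurable_fun => // x /set_mem.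
  exact: cf.
- by move=> x Ix /=; rewrite lee_fin (le_trans (fg _ Ix))// ler_norm.
Qed.

Lemma eq_in_integrable (R : realType) (I : set R) (f g : R -> R) :
  measurable I -> (forall x, I x -> f x = g x) ->
  mu.-integrable I (EFin \o f) -> mu.-integrable I (EFin \o g).
Proof.
by move=> mI fg; apply: eq_integrable => // x /set_mem Ix /=; rewrite fg.
Qed.

Lemma scaled_integrable (R : realType) (I : set R) (f : R -> R) (k : R) :
  measurable I -> mu.-integrable I (EFin \o f) ->
  mu.-integrable I (EFin \o (fun x => k * f x)).
Proof. by move=> mI; exact: integrableZl. Qed.

(** * Self-similar profiles *)

(* [Phi] is a primitive of [h] beyond -1 only, so that 0 is an interior point. *)
Record profile (R : realType) (rho : R) (h h1 h2 Phi : R -> R) : Prop := Profile {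
  profileN : forall y, h (- y) = h y;
  profile_ge0 : forall y, 0 <= h y;
  profile_noninc : forall x y : R, 0 <= x -> x <= y -> h y <= h x;
  profile_D1 : forall y : R, is_derive y 1 h (h1 y);
  profile_D2 : forall y : R, is_derive y 1 h1 (h2 y);
  profile_ode : forall y,
    y * h2 y + (2 + y ^+ 2) * h1 y + (1 + 2 * rho) * (y * h y) = 0;
  profile_bound : exists C, forall y, `|y * h1 y| <= C;
  profile_prim : forall y : R, -1 < y -> is_derive y 1 Phi (h y);
  profile_prim0 : Phi 0 = 0;
  profile_mass : Phi y @[y --> +oo] --> (2^-1 : R) }.

Lemma is_derive_continuous (R : realType) (f : R -> R) (x df : R) :
  is_derive x 1 f df -> {for x, continuous f}.
Proof.
by move=> [fx _]; apply: differentiable_continuous; apply/derivable1_diffP.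
Qed.

Lemma inv_cvgy0 (R : realType) : (y : R)^-1 @[y --> +oo] --> (0 : R).
Proof.
apply/cvgrPdist_le => e e0; near=> y.
have y0 : e^-1 < y by near: y; apply: nbhs_pinfty_gt; rewrite num_real.
have y1 : 0 < y by rewrite (lt_trans _ y0)// invr_gt0.
rewrite sub0r normrN gtr0_norm ?invr_gt0//.
by rewrite -[leRHS]invrK lef_pV2 ?posrE ?invr_gt0// ltW.
Unshelve. all: by end_near. Qed.

Lemma bounded_div_cvg0 (R : realType) (g : R -> R) : (exists C, forall y, `|g y| <= C) ->
  g y / y @[y --> +oo] --> (0 : R).
Proof.
move=> [C gC].
apply: norm_cvg0; apply: (@squeeze_cvgr _ _ _ _ (cst 0) (fun y => C * y^-1)).
- near=> y; rewrite normr_ge0/= normrM ler_pM// ger0_norm// invr_ge0.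
  by near: y; apply: nbhs_pinfty_ge; rewrite num_real.
- exact: cvg_cst.
- by rewrite -(mulr0 C); apply: cvgM; [exact: cvg_cst|exact: inv_cvgy0].
Unshelve. all: by end_near. Qed.

Section profile_theory.
Context {R : realType}.
Variables (rho : R) (h h1 h2 Phi : R -> R).
Hypothesis hP : profile rho h h1 h2 Phi.

(** This is k of the overview, and the two definitions that follow are D and m. Up to a power of t,
    k is the profile of the time derivative of the solution. *)
Definition drift (y : R) := h y + y * h1 y.
Definition memory_slope (y : R) := rho - y * h y - 2 * rho * Phi y.
Definition memory_profile (y : R) := y * memory_slope y - drift y.

Lemma profile_le0 y : h y <= h 0.
Proof.
have [y0|y0] := leP 0 y; first exact: (profile_noninc hP).
by rewrite -(profileN hP); apply: (profile_noninc hP) => //; rewrite oppr_ge0 ltW.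
Qed.

Lemma profile_continuous : continuous h.
Proof. by move=> y; apply: is_derive_continuous; exact: (profile_D1 hP). Qed.

Lemma drift_bounded : exists C, forall y, `|drift y| <= C.
Proof.
have [C hC] := profile_bound hP; exists (h 0 + C) => y.
rewrite (le_trans (ler_normD _ _))// lerD//.
by rewrite ger0_norm ?profile_le0//; exact: (profile_ge0 hP).
Qed.

Lemma memory_slope_derive (y : R) : -1 < y ->
  is_derive y 1 memory_slope (- (drift y + 2 * rho * h y)).
Proof.
move=> y0.
have := profile_D1 hP y; have := profile_prim hP y0 => dPhi dh.
apply: is_derive_eq.
by rewrite /drift/= /GRing.scale/=; ring.
Qed.

(** The profile equation enters the argument here, in the form k' = y D'. With m = y D - k this
    gives m' = D. *)
Lemma drift_derive (y : R) : is_derive y 1 drift (- y * (drift y + 2 * rho * h y)).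
Proof.
have := profile_D1 hP y; have := profile_D2 hP y => dh1 dh.
apply: is_derive_eq.
rewrite /drift/= /GRing.scale/=.
have := profile_ode hP y => ode.
apply/eqP; rewrite -subr_eq0; apply/eqP; rewrite -[RHS]ode; ring.
Qed.

Lemma driftN y : drift (- y) = drift y.
Proof.
have d1 : is_derive y 1 (h \o -%R) (h1 (- y) * - 1).
  by apply: is_derive1_comp; exact: (profile_D1 hP).
have hN : h \o -%R = h by apply/funext => z /=; exact: (profileN hP).
rewrite hN in d1; rewrite /drift (profileN hP).
have [_ <-] := profile_D1 hP y; have [_ ->] := d1.
by rewrite mulrN1 mulrN mulNr.
Qed.

Lemma drift_continuous : continuous drift.
Proof. by move=> y; apply: is_derive_continuous; exact: drift_derive. Qed.

Lemma memory_profile_derive (y : R) : -1 < y ->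
  is_derive y 1 memory_profile (memory_slope y).
Proof.
move=> y0.
have := memory_slope_derive y0; have := drift_derive y => dk dD.
apply: is_derive_eq.
by rewrite /= /GRing.scale/=; ring.
Qed.

(** A nonincreasing function of finite mass is o(1/y): the mass on [y/2, y] is at least (y/2) h(y)
    and tends to 0 because [Phi] converges. *)
Lemma profile_mul_cvg0 : y * h y @[y --> +oo] --> (0 : R).
Proof.
apply: (@squeeze_cvgr _ _ _ _ (cst 0) (fun y => 2 * (Phi y - Phi (y / 2)))).
- near=> y.
  have y0 : 0 < y by near: y; apply: nbhs_pinfty_gt; rewrite num_real.
  apply/andP; split; first by rewrite mulr_ge0 ?(profile_ge0 hP) 1?ltW.
  have [|||c] := @MVT _ Phi h (y / 2) y.
  + by rewrite ltr_pdivrMr// ltr_pMr// ltr1n.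
  + move=> x; rewrite in_itv/= => /andP[x0 _]; apply: (profile_prim hP).
    by rewrite (lt_trans _ x0)// (lt_trans (ltrN10 _))// divr_gt0.
  + apply: derivable_within_continuous => x; rewrite in_itv/= => /andP[x0 _].
    have /(profile_prim hP)[//] : -1 < x.
    by rewrite (lt_le_trans _ x0)// (lt_trans (ltrN10 _))// divr_gt0.
  + rewrite in_itv/= => /andP[c0 cy] ->.
    have : h y <= h c by apply: (profile_noninc hP) (ltW cy); lra.
    move=> /(ler_wpM2l (ltW y0)); lra.
- exact: cvg_cst.
- rewrite -(mulr0 2) -[X in _ * X](subrr (2^-1 : R)).
  apply: cvgM; first exact: cvg_cst.
  apply: cvgB; first exact: (profile_mass hP).
  apply: (@cvg_comp _ _ _ (fun y : R => y / 2) Phi); last exact: (profile_mass hP).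
  by move=> A /near_pinfty_div2.
Unshelve. all: by end_near. Qed.

(** The value 1/2 of the half mass is decisive: it makes rho - 2 rho Phi tend to 0. *)
Lemma memory_slope_cvg0 : memory_slope y @[y --> +oo] --> (0 : R).
Proof.
have -> : 0 = rho - 0 - 2 * rho * 2^-1 :> R by field.
apply: cvgB.
  by apply: cvgB; [exact: cvg_cst|exact: profile_mul_cvg0].
by apply: cvgM; [exact: cvg_cst|exact: (profile_mass hP)].
Qed.

Lemma memory_profile_div_cvg0 : memory_profile y / y @[y --> +oo] --> (0 : R).
Proof.
have : memory_slope y - drift y / y @[y --> +oo] --> (0 : R).
  rewrite -(subr0 0); apply: cvgB; first exact: memory_slope_cvg0.
  exact: bounded_div_cvg0 drift_bounded.
apply: cvg_trans; apply: near_eq_cvg; near=> y.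
have y0 : y != 0.
  by rewrite gt_eqF//; near: y; apply: nbhs_pinfty_gt; rewrite num_real.
by rewrite /memory_profile; field.
Unshelve. all: by end_near. Qed.

Lemma profile_cvg0 : h y @[y --> +oo] --> (0 : R).
Proof.
have : y * h y * y^-1 @[y --> +oo] --> (0 : R).
  by rewrite -(mulr0 0); apply: cvgM; [exact: profile_mul_cvg0|exact: inv_cvgy0].
apply: cvg_trans; apply: near_eq_cvg; near=> y.
have y0 : y != 0.
  by rewrite gt_eqF//; near: y; apply: nbhs_pinfty_gt; rewrite num_real.
by rewrite mulrAC divff ?mul1r.
Unshelve. all: by end_near. Qed.

End profile_theory.

(** * Pairing with test functions *)

Lemma segment_integrable (R : realType) (f : R -> R) (a b : R) :
  (forall x, a <= x <= b -> {for x, continuous f}) ->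
  mu.-integrable `[a, b] (EFin \o f).
Proof.
move=> cf; apply: continuous_compact_integrable; first exact: segment_compact.
apply: continuous_in_subspaceT => x; rewrite inE/= in_itv/=; exact: cf.
Qed.

Lemma continuous_locally_integrable (R : realType) (f : R -> R) :
  continuous f -> locally_integrable setT f.
Proof.
move=> cf; split.
- exact: continuous_measurable_fun.
- exact: openT.
- move=> K _ cK.
  have : mu.-integrable K (EFin \o f).
    apply: continuous_compact_integrable => //.
    exact: continuous_subspaceT.
  by case/integrableP.
Qed.

(** The solution, its time derivative and its memory integral are even in x, and their profiles are
    studied on the half-line only; folding moves the whole pairing there. *)
Lemma Rintegral_fold (R : realType) (F : R -> R) (M : R) : 0 < M ->
  continuous F -> (forall x, M < `|x| -> F x = 0) ->
  \int[mu]_x F x = \int[mu]_(x in `[0, M]) (F x + F (- x)).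
Proof.
move=> M0 cF F0.
have iF a b : mu.-integrable `[a, b] (EFin \o F).
  by apply: segment_integrable => x _; exact: cF.
have cFN : continuous (F \o -%R).
  by move=> x; apply: continuous_comp; [exact: opp_continuous|exact: cF].
have iFN a b : mu.-integrable `[a, b] (EFin \o (F \o -%R)).
  by apply: segment_integrable => x _; exact: cFN.
transitivity (\int[mu]_(x in `[- M, M]) F x).
  rewrite [RHS]Rintegral_mkcond; congr Rintegral; apply/funext => x.
  rewrite patchE; case: ifPn => // /negP xM.
  apply: F0; rewrite ltNge; apply/negP; rewrite ler_norml => xM'.
  by apply: xM; rewrite inE/= in_itv.
have -> : \int[mu]_(x in `[- M, M]) F x =
    \int[mu]_(x in `[- M, 0]) F x + \int[mu]_(x in `[0, M]) F x.
  rewrite -(@Rintegral_itv_obnd_cbnd _ 0); last first.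
    apply: (integrableS _ _ _ (iF 0 M)) => //.
    by move=> x; rewrite /= !in_itv/= => /andP[/ltW -> ->].
  rewrite -(@Rintegral_itvB _ F (BLeft (- M)) (BRight M) 0).
  - by rewrite addrC subrK.
  - exact: iF.
  - by rewrite bnd_simp lerNl oppr0 ltW.
  - by rewrite bnd_simp ltW.
rewrite RintegralD; [|by []|exact: iF|exact: iFN].
rewrite addrC; congr +%R.
rewrite /Rintegral; congr fine.
rewrite -[X in `[- M, X]]oppr0 integration_by_substitution_oppr ?ltW//.
exact: continuous_subspaceT.
Qed.

Lemma regular_even (R : realType) (g phi : R -> R) (M : R) : 0 < M ->
  continuous g -> (forall x, g (- x) = g x) -> continuous phi ->
  (forall x, M < `|x| -> phi x = 0) ->
  regular g phi = \int[mu]_(x in `[0, M]) (g x * (phi x + phi (- x))).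
Proof.
move=> M0 cg gN cphi phi0; rewrite /regular (@Rintegral_fold _ _ M)//.
- by apply: eq_Rintegral => x _; rewrite gN mulrDr.
- by move=> x; apply: cvgM; [exact: cg|exact: cphi].
- by move=> x /phi0 ->; rewrite mulr0.
Qed.

Lemma derive1_eq0 (R : realType) (phi : R -> R) (M : R) :
  (forall x, M < `|x| -> phi x = 0) ->
  forall x, M < `|x| -> (phi^`())%classic x = 0.
Proof.
move=> phi0 x Mx; rewrite derive1E.
rewrite (@near_eq_derive _ _ _ _ (cst 0)) ?derive_cst//.
near=> y; apply: phi0; near: y.
have : `|y| @[y --> x] --> `|x| by apply: cvg_norm; exact: cvg_id.
by move=> /cvgr_gt; apply.
Unshelve. all: by end_near. Qed.

(** Collects what integration by parts on [0, M] consumes. Both boundary values vanish at M by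
    compact support, and psi' vanishes at 0 because psi is even. Two distributional derivatives cost
    two signs, so they amount to pairing with phi''. *)
Lemma test_function_fold (R : realType) (phi : R -> R) : test_function phi ->
  exists (M : R) (psi1 psi2 : R -> R), let psi x := phi x + phi (- x) in
  [/\ 0 < M /\ continuous psi2,
      forall x : R, is_derive x 1 psi (psi1 x),
      forall x : R, is_derive x 1 psi1 (psi2 x),
      psi M = 0 /\ psi1 M = 0 /\ psi1 0 = 0 &
      forall g : R -> R, continuous g -> (forall x, g (- x) = g x) ->
        regular g phi = \int[mu]_(x in `[0, M]) (g x * psi x) /\
        ddist (ddist (regular g)) phi = \int[mu]_(x in `[0, M]) (g x * psi2 x)].
Proof.
move=> [dphi [M0 phi0]].
pose phi1 := (phi^`())%classic; pose phi2 := (phi1^`())%classic.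
have d0 (x : R) : is_derive x 1 phi (phi1 x).
  by apply: DeriveDef; [exact: (dphi 0%N x)|rewrite /phi1 derive1E].
have d1 (x : R) : is_derive x 1 phi1 (phi2 x).
  by apply: DeriveDef; [have := dphi 1%N x; rewrite derive1n1|
                        rewrite /phi2 derive1E].
have c0 : continuous phi by move=> x; exact: is_derive_continuous (d0 x).
have c2 : continuous phi2.
  move=> x; apply: differentiable_continuous; apply/derivable1_diffP.
  by have := dphi 2%N x; rewrite derive1nS derive1n1.
(* The absolute value makes M positive whatever the sign of [M0]; adding 1 makes phi and its
   derivative vanish at M itself, not merely beyond it. *)
pose M := `|M0| + 1.
have phi00 x : M <= `|x| -> phi x = 0.
  by move=> Mx; apply: phi0; rewrite (le_lt_trans (ler_norm _))//
      (lt_le_trans _ Mx)// ltrDl.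
have phi10 x : M <= `|x| -> phi1 x = 0.
  move=> Mx; apply: (@derive1_eq0 _ _ M0) => //.
  by rewrite (le_lt_trans (ler_norm _))//
      (lt_le_trans _ Mx)// ltrDl.
have phi20 x : M < `|x| -> phi2 x = 0.
  by move=> Mx; apply: (@derive1_eq0 _ _ M) => // y /ltW; exact: phi10.
have Mgt0 : 0 < M by rewrite ltr_wpDl.
exists M, (fun x => phi1 x - phi1 (- x)), (fun x => phi2 x + phi2 (- x)); split => //.
- split => // x; apply: cvgD; first exact: c2.
  by apply: (@continuous_comp _ _ _ -%R phi2); [exact: opp_continuous|exact: c2].
- move=> x.
  have dN : is_derive x 1 (phi \o -%R) (phi1 (- x) * - 1).
    by apply: is_derive1_comp.
  by apply: is_derive_eq; rewrite mulrN1.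
- move=> x.
  have dN : is_derive x 1 (phi1 \o -%R) (phi2 (- x) * - 1).
    by apply: is_derive1_comp.
  by apply: is_derive_eq; rewrite mulrN1 opprK.
- have nM : `|M| = M by rewrite gtr0_norm.
  rewrite phi00 ?nM// phi00 ?normrN ?nM// phi10 ?nM// phi10 ?normrN ?nM//.
  by rewrite addr0 subr0 oppr0 subrr.
- move=> g cg gN; split.
    by apply: regular_even => // x /ltW; exact: phi00.
  by rewrite /ddist opprK; exact: regular_even.
Qed.

(** * Self-similar solutions *)

(** The offset 3 keeps the segments nondegenerate from n = 0 on, since 2 t / (3 + n) < t; both ends
    stay inside the open interval. *)
Lemma mem_exhaust0 (R : realType) (t : R) (x : R) : 0 < t ->
  `]0, t[%classic x ->
  \forall n \near \oo, t / (3 + n%:R) <= x <= t - t / (3 + n%:R).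
Proof.
move=> t0; rewrite /= in_itv/= => /andP[x0 xt].
near=> n.
have n3 : 0 < 3 + n%:R :> R by rewrite ltr_wpDr.
have n1 : t / x <= n%:R by near: n; exact: nbhs_infty_ger.
have n2 : t / (t - x) <= n%:R by near: n; exact: nbhs_infty_ger.
apply/andP; split.
  rewrite ler_pdivrMr// mulrC -ler_pdivrMr// (le_trans n1)//.
  by rewrite lerDr.
rewrite lerBrDl -lerBrDr ler_pdivrMr// mulrC -ler_pdivrMr ?subr_gt0//.
by rewrite (le_trans n2)// lerDr.
Unshelve. all: by end_near. Qed.

Lemma exhaust0_lt (R : realType) (t : R) (n : nat) : 0 < t ->
  t / (3 + n%:R) < t - t / (3 + n%:R).
Proof.
move=> t0; have n3 : 0 < 3 + n%:R :> R by rewrite ltr_wpDr.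
rewrite ltrBrDl -mulrDl ltr_pdivrMr//.
by have := mulr_ge0 (ltW t0) (ler0n R n); lra.
Qed.

Lemma exhaust0_sub (R : realType) (t : R) (n : nat) : 0 < t ->
  `[t / (3 + n%:R), t - t / (3 + n%:R)] `<=` `]0, t[.
Proof.
move=> t0 x; have n3 : 0 < 3 + n%:R :> R by rewrite ltr_wpDr.
have tn : 0 < t / (3 + n%:R) by rewrite divr_gt0.
rewrite /= !in_itv/= => /andP[x1 x2].
by rewrite (lt_le_trans tn x1)/= (le_lt_trans x2)// gtrBl.
Qed.

Lemma exhaust0_cvg (R : realType) (t : R) : 0 < t ->
  t / (3 + n%:R) @[n --> \oo] --> (0 : R).
Proof.
move=> t0; apply/cvgrPdist_le => e e0; near=> n.
have n3 : 0 < 3 + n%:R :> R by rewrite ltr_wpDr.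
rewrite sub0r normrN gtr0_norm ?divr_gt0// ler_pdivrMr// mulrC -ler_pdivrMr//.
have n1 : t / e <= n%:R by near: n; exact: nbhs_infty_ger.
by rewrite (le_trans n1)// lerDr.
Unshelve. all: by end_near. Qed.

Lemma exhaust0_cvgr (R : realType) (t : R) : 0 < t ->
  t - t / (3 + n%:R) @[n --> \oo] --> t.
Proof.
move=> t0; have : t - t / (3 + n%:R) @[n --> \oo] --> t - 0.
  by apply: cvgB; [exact: cvg_cst|exact: exhaust0_cvg].
by rewrite subr0.
Qed.

Lemma itv0_FTC2 (R : realType) (f F : R -> R) (t l : R) : 0 < t ->
  (forall x : R, 0 < x -> is_derive x 1 F (f x)) ->
  (forall x, 0 < x -> {for x, continuous f}) ->
  F x @[x --> 0^'+] --> l ->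
  mu.-integrable `]0, t[ (EFin \o f) ->
  \int[mu]_(x in `]0, t[) f x = F t - l.
Proof.
move=> t0 dF cf Fl intf; rewrite /Rintegral.
transitivity (fine (F t - l)%:E) => //; congr fine.
apply: (@open_FTC2 _ f F _ (fun n => t / (3 + n%:R))
  (fun n => t - t / (3 + n%:R))).
- exact: interval_open.
- by move=> n; exact: exhaust0_lt.
- by move=> n; exact: exhaust0_sub.
- by move=> x; exact: mem_exhaust0.
- by move=> x; rewrite /= in_itv/= => /andP[x0 _]; exact: dF.
- by move=> x; rewrite /= in_itv/= => /andP[x0 _]; exact: cf.
- apply: cvgB.
    have cF : {for t, continuous F} by exact: is_derive_continuous (dF _ t0).
    apply: (@cvg_comp _ _ _ (fun n => t - t / (3 + n%:R)) F _ (nbhs t)) => //.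
    exact: exhaust0_cvgr.
  move/cvg_at_rightP : Fl; apply; split; last exact: exhaust0_cvg.
  by move=> n; rewrite divr_gt0// ltr_wpDr.
- exact: intf.
Qed.

(** Provides the dominating function of the memory integrand near time 0, where the exponent [a - 1]
    may be negative; the primitive z^a / a has the limit 0 there. *)
Lemma powR_itv0_integrable (R : realType) (a t : R) : 0 < a -> 0 < t ->
  mu.-integrable `]0, t[ (fun z => (z `^ (a - 1))%:E).
Proof.
move=> a0 t0.
apply: (@ge0_open_FTC2_integrable _ (fun z => z `^ (a - 1))
  (fun z => a^-1 * z `^ a) _ (fun n => t / (3 + n%:R))
  (fun n => t - t / (3 + n%:R)) (a^-1 * t `^ a - a^-1 * 0)).
- exact: interval_open.
- by move=> x _; exact: powR_ge0.
- by move=> n; exact: exhaust0_lt.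
- by move=> n; exact: exhaust0_sub.
- by move=> x; exact: mem_exhaust0.
- move=> x; rewrite /= in_itv/= => /andP[x0 _].
  have dp := is_derive1_powR a x0.
  by apply: is_derive_eq; rewrite /GRing.scale/= mulrA mulVf ?mul1r// gt_eqF.
- move=> x; rewrite /= in_itv/= => /andP[x0 _].
  exact: is_derive_continuous (is_derive1_powR _ x0).
- apply: cvgB; (apply: cvgM; first exact: cvg_cst).
    have cp : {for t, continuous (fun z => z `^ a)}.
      exact: is_derive_continuous (is_derive1_powR _ t0).
    by apply: (continuous_cvg _ cp); exact: exhaust0_cvgr.
  move/cvg_at_rightP : (powR_cvg0 a0); apply; split; last exact: exhaust0_cvg.
  by move=> n; rewrite divr_gt0// ltr_wpDr.
Qed.

Lemma powR_mulNN (R : realType) (z b : R) : 0 < z -> z `^ b * z `^ (- b) = 1.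
Proof. by move=> z0; rewrite powRN divff// gt_eqF// powR_gt0. Qed.

Lemma powR_sub1 (R : realType) (z b : R) : 0 < z -> z `^ (b - 1) = z `^ b / z.
Proof.
by move=> z0; rewrite powRB ?(gt_eqF z0) ?implybT// powRr1// ltW.
Qed.

Lemma powRN_cvgy (R : realType) (b : R) : 0 < b ->
  z `^ (- b) @[z --> 0^'+] --> (+oo : set_system R).
Proof.
move=> b0; apply/cvgryPge => C.
have C1 : 0 < (`|C| + 1)^-1 by rewrite invr_gt0 ltr_wpDl.
have /cvgrPdist_le/(_ _ C1) := powR_cvg0 b0.
apply: filter_app; near=> z.
have z0 : 0 < z by near: z; exact: nbhs_right_gt.
rewrite sub0r normrN ger0_norm ?powR_ge0// => zC.
rewrite (le_trans (ler_norm _))// (@le_trans _ _ (`|C| + 1)) ?lerDl//.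
by rewrite powRN -[leLHS]invrK lef_pV2// posrE powR_gt0.
Unshelve. all: by end_near. Qed.

Section profile_solution.
Context {R : realType}.
Variables (alpha rho : R) (h h1 h2 Phi : R -> R) (f : R -> R -> R).
Hypothesis alpha_gt0 : 0 < alpha.
Hypothesis hP : profile rho h h1 h2 Phi.
Let a := alpha / 2.
Hypothesis fE : forall x t, 0 < t -> f x t = t `^ (- a) * h (x * t `^ (- a)).

Let a_gt0 : 0 < a. Proof. by rewrite divr_gt0. Qed.

Let alphaE : alpha = a + a. Proof. by rewrite /a; field. Qed.

Lemma selfsimilar_derive (x t : R) : 0 < t ->
  is_derive t 1 (f x) (- a * t `^ (- a - 1) * drift h h1 (x * t `^ (- a))).
Proof.
move=> t0.
apply: (@near_eq_is_derive _ _ _ (fun s => s `^ (- a) * h (x * s `^ (- a)))).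
  near=> s; rewrite fE//; near: s; exact: lt_nbhsr.
have dp := is_derive1_powR (- a) t0.
have dh : is_derive t 1 (h \o (fun s => x * s `^ (- a)))
    (h1 (x * t `^ (- a)) * (x * (- a * t `^ (- a - 1)))).
  apply: is_derive1_comp; first exact: (profile_D1 hP).
apply: is_derive_eq.
by rewrite /drift /GRing.scale/=; ring.
Unshelve. all: by end_near. Qed.

Lemma selfsimilar_dt (x t : R) : 0 < t ->
  dt f x t = - a * t `^ (- a - 1) * drift h h1 (x * t `^ (- a)).
Proof. by move=> /(selfsimilar_derive x)[_ <-]; rewrite /dt derive1E. Qed.

(** The weight t^alpha raises the exponent - a - 1 of the time derivative to a - 1, which is
    integrable at 0. Since k is bounded, the memory integral converges absolutely. *)
Lemma memory_integrandE (x t : R) : 0 < t ->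
  t `^ alpha * dt f x t = - a * t `^ (a - 1) * drift h h1 (x * t `^ (- a)).
Proof.
move=> t0; rewrite selfsimilar_dt// alphaE.
have -> : a - 1 = (a + a) + (- a - 1) by ring.
by rewrite [t `^ (a + a + _)]powRD ?(gt_eqF t0) ?implybT//; ring.
Qed.

Lemma memory_integrand_cvg (x t : R) : 0 < t ->
  {for t, continuous (fun s => - a * s `^ (a - 1) * drift h h1 (x * s `^ (- a)))}.
Proof.
move=> t0.
have cp b : {for t, continuous (fun s => s `^ b)}.
  exact: is_derive_continuous (is_derive1_powR _ t0).
apply: cvgM.
  by apply: cvgM; [exact: cvg_cst|exact: cp].
apply: (@continuous_comp _ _ _ (fun s => x * s `^ (- a)) (drift h h1)).
  by apply: cvgM; [exact: cvg_cst|exact: cp].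
exact: (drift_continuous hP).
Qed.

Lemma memory_integrable (x t : R) : 0 < t ->
  mu.-integrable `]0, t[ (fun z => (z `^ alpha * dt f x z)%:E).
Proof.
move=> t0.
apply: (@eq_in_integrable _ _ (fun z => - a * z `^ (a - 1) *
    drift h h1 (x * z `^ (- a)))) => //.
  by move=> z; rewrite /= in_itv/= => /andP[z0 _]; rewrite memory_integrandE.
have [C kC] := drift_bounded hP.
apply: (@open_dominated_integrable _ _ _ (fun z => a * C * z `^ (a - 1))).
- exact: interval_open.
- move=> z; rewrite /= in_itv/= => /andP[z0 _]; exact: memory_integrand_cvg.
- move=> z _; rewrite !normrM normrN (gtr0_norm a_gt0).
  rewrite (ger0_norm (powR_ge0 _ _)).
  by rewrite mulrAC ler_wpM2r ?powR_ge0// ler_wpM2l// ltW.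
- by apply: scaled_integrable => //; exact: powR_itv0_integrable.
Qed.

(** With y = x z^(-a), the product rule gives a z^(a-1) (m(y) - y D(y)), and m - y D = - k by
    definition. Taking x nonnegative keeps y where [Phi] is a primitive. *)
Lemma memory_prim_derive (x z : R) : 0 <= x -> 0 < z ->
  is_derive z 1 (fun s => s `^ a * memory_profile rho h h1 Phi (x * s `^ (- a)))
    (- a * z `^ (a - 1) * drift h h1 (x * z `^ (- a))).
Proof.
move=> x0 z0.
have dp := is_derive1_powR a z0; have dn := is_derive1_powR (- a) z0.
have y0 : -1 < x * z `^ (- a).
  by rewrite (lt_le_trans (ltrN10 _))// mulr_ge0 ?powR_ge0.
have dm : is_derive z 1 (memory_profile rho h h1 Phi \o (fun s => x * s `^ (- a)))
    (memory_slope rho h Phi (x * z `^ (- a)) * (x * (- a * z `^ (- a - 1)))).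
  by apply: is_derive1_comp; exact: (memory_profile_derive hP).
apply: is_derive_eq.
rewrite /memory_profile /GRing.scale/= !powR_sub1//.
(* From here on the two powers are independent atoms P and N, tied only by P N = 1. *)
have := powR_mulNN a z0; set P := z `^ a; set N := z `^ (- a) => PN.
have -> : P * (memory_slope rho h Phi (x * N) * (x * (- a * (N / z)))) =
   (P * N) * (memory_slope rho h Phi (x * N) * x * - a / z) by ring.
by rewrite PN; field: PN; rewrite gt_eqF.
Qed.

(** For x > 0 the expression is x m(y)/y with y = x z^(-a) going to +oo. For x = 0 the argument y
    stays at 0, and the prefactor z^a alone tends to 0. *)
Lemma memory_prim_cvg0 (x : R) : 0 <= x ->
  z `^ a * memory_profile rho h h1 Phi (x * z `^ (- a)) @[z --> 0^'+] --> (0 : R).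
Proof.
rewrite le_eqVlt => /predU1P[<-|x0].
  under eq_fun do rewrite mul0r.
  have : z `^ a * memory_profile rho h h1 Phi 0 @[z --> 0^'+] -->
      0 * memory_profile rho h h1 Phi 0.
    by apply: cvgM; [exact: powR_cvg0|exact: cvg_cst].
  by rewrite mul0r.
have : x * (memory_profile rho h h1 Phi (x * z `^ (- a)) / (x * z `^ (- a)))
    @[z --> 0^'+] --> x * 0.
  apply: cvgM; first exact: cvg_cst.
  apply: (@cvg_comp _ _ _ (fun z => x * z `^ (- a))
    (fun y => memory_profile rho h h1 Phi y / y) _ +oo);
    last exact: (memory_profile_div_cvg0 hP).
  exact: (gt0_cvgMry x0 (powRN_cvgy a_gt0)).
rewrite mulr0; apply: cvg_trans; apply: near_eq_cvg; near=> z.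
have z0 : 0 < z by near: z; exact: nbhs_right_gt.
rewrite powRN; have zn : z `^ a != 0 by rewrite gt_eqF// powR_gt0.
by field; rewrite zn gt_eqF.
Unshelve. all: by end_near. Qed.

Lemma memoryE (x t : R) : 0 < t ->
  memory alpha f x t = t `^ a * memory_profile rho h h1 Phi (`|x| * t `^ (- a)).
Proof.
move=> t0.
transitivity (\int[mu]_(z in `]0, t[)
    (- a * z `^ (a - 1) * drift h h1 (`|x| * z `^ (- a)))).
  apply: eq_Rintegral => z; rewrite inE/= in_itv/= => /andP[z0 _].
  rewrite memory_integrandE//; have [x0|x0] := leP 0 x; first by rewrite ger0_norm.
  by rewrite ltr0_norm// [- x * _]mulNr (driftN hP).
rewrite -[RHS]subr0.
apply: (@itv0_FTC2 _ _
  (fun s => s `^ a * memory_profile rho h h1 Phi (`|x| * s `^ (- a)))) => //.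
- by move=> z z0; exact: memory_prim_derive.
- by move=> z; exact: memory_integrand_cvg.
- exact: memory_prim_cvg0.
- have := memory_integrable `|x| t0; apply: eq_in_integrable => // z.
  by rewrite /= in_itv/= => /andP[z0 _]; rewrite memory_integrandE.
Qed.

Lemma selfsimilar_continuous (t : R) : 0 < t -> continuous (f ^~ t).
Proof.
move=> t0; rewrite (_ : f ^~ t = fun x => t `^ (- a) * h (x * t `^ (- a))).
  move=> x; apply: cvgM; first exact: cvg_cst.
  apply: (@continuous_comp _ _ _ (fun x : R => x * t `^ (- a)) h).
    by apply: cvgM; [exact: cvg_id|exact: cvg_cst].
  exact: (profile_continuous hP).
by apply/funext => x; rewrite fE.
Qed.

Lemma dt_continuous (t : R) : 0 < t -> continuous (dt f ^~ t).
Proof.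
move=> t0; rewrite (_ : dt f ^~ t =
    fun x => - a * t `^ (- a - 1) * drift h h1 (x * t `^ (- a))).
  move=> x; apply: cvgM; first exact: cvg_cst.
  apply: (@continuous_comp _ _ _ (fun x : R => x * t `^ (- a)) (drift h h1)).
    by apply: cvgM; [exact: cvg_id|exact: cvg_cst].
  exact: (drift_continuous hP).
by apply/funext => x; rewrite selfsimilar_dt.
Qed.

Lemma memory_continuous (t : R) : 0 < t -> continuous (memory alpha f ^~ t).
Proof.
move=> t0; rewrite (_ : memory alpha f ^~ t =
    fun x => t `^ a * memory_profile rho h h1 Phi (`|x| * t `^ (- a))).
  move=> x; apply: cvgM; first exact: cvg_cst.
  apply: (@continuous_comp _ _ _ (fun x : R => `|x| * t `^ (- a))
      (memory_profile rho h h1 Phi)).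
    by apply: cvgM; [exact: norm_continuous|exact: cvg_cst].
  apply: is_derive_continuous (memory_profile_derive hP _).
  by rewrite (lt_le_trans (ltrN10 _))// mulr_ge0 ?powR_ge0.
by apply/funext => x; rewrite memoryE.
Qed.

Lemma profile_terms_well_defined : terms_well_defined alpha f.
Proof.
move=> t t0; split.
- by move=> x; have [] := selfsimilar_derive x t0.
- by move=> x; exact: memory_integrable.
- by apply: continuous_locally_integrable; exact: selfsimilar_continuous.
- by apply: continuous_locally_integrable; exact: dt_continuous.
- by apply: continuous_locally_integrable; exact: memory_continuous.
Qed.

(** Two integrations by parts on the half-line. The term [rho * psi 0] is the contribution of the
    corner of the memory integral at x = 0: half of the slope jump 2 rho, paired with psi(0) = 2
    phi(0). *)
Lemma weak_memory (t M : R) (psi psi1 psi2 : R -> R) : 0 < t -> 0 < M ->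
  (forall x : R, is_derive x 1 psi (psi1 x)) ->
  (forall x : R, is_derive x 1 psi1 (psi2 x)) ->
  continuous psi2 -> psi M = 0 -> psi1 M = 0 -> psi1 0 = 0 ->
  let q := t `^ (- a) in
  \int[mu]_(x in `[0, M]) (memory alpha f x t * psi2 x) =
  rho * psi 0 - q * \int[mu]_(x in `[0, M]) (drift h h1 (x * q) * psi x)
  - 2 * rho * q * \int[mu]_(x in `[0, M]) (h (x * q) * psi x).
Proof.
move=> t0 M0 dpsi dpsi1 cpsi2 psiM psi1M psi10 q.
have q0 : 0 < q by rewrite powR_gt0.
have Pq : t `^ a * q = 1 by exact: powR_mulNN.
have cq (x : R) : {for x, continuous (fun x : R => x * q)}.
  by apply: cvgM; [exact: cvg_id|exact: cvg_cst].
have cpsi : continuous psi by move=> x; exact: is_derive_continuous (dpsi x).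
have cA : continuous (fun x : R => drift h h1 (x * q) * psi x).
  move=> x; apply: cvgM; last exact: cpsi.
  apply: (@continuous_comp _ _ _ (fun x : R => x * q) (drift h h1)); first exact: cq.
  exact: (drift_continuous hP).
have cB : continuous (fun x : R => h (x * q) * psi x).
  move=> x; apply: cvgM; last exact: cpsi.
  apply: (@continuous_comp _ _ _ (fun x : R => x * q) h); first exact: cq.
  exact: (profile_continuous hP).
have cC : continuous (fun x : R => memory alpha f x t * psi2 x).
  by move=> x; apply: cvgM; [exact: memory_continuous|exact: cpsi2].
pose g (x : R) := memory alpha f x t * psi2 x + (q * (drift h h1 (x * q) * psi x) +
  2 * rho * q * (h (x * q) * psi x)).
have cg : continuous g.
  move=> x; apply: cvgD; first exact: cC.
  by apply: cvgD; (apply: cvgM; first exact: cvg_cst); [exact: cA|exact: cB].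
have int_g : \int[mu]_(x in `[0, M]) g x = rho * psi 0.
  transitivity (fine (0 - (- (rho * psi 0)))%:E); last by rewrite /= sub0r opprK.
  congr fine.
  (* Both integrations by parts as one exact primitive: since t^a q = 1, the terms D psi' cancel in
     G', and D' turns the last one into k and h. At 0 only - D(0) psi(0) survives. *)
  pose G (x : R) := t `^ a * memory_profile rho h h1 Phi (x * q) * psi1 x
              - memory_slope rho h Phi (x * q) * psi x.
  have -> : 0 - - (rho * psi 0) = G M - G 0.
    have -> : G M = 0 by rewrite /G psi1M psiM !mulr0 subrr.
    have D0 : memory_slope rho h Phi (0 * q) = rho.
      by rewrite mul0r /memory_slope (profile_prim0 hP) mul0r mulr0 !subr0.
    by rewrite /G psi10 D0 mulr0 !sub0r.
  apply: (@segment_FTC2 _ g G 0 M M0) => x /andP[x0 _]; last exact: cg.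
  have y0 : -1 < x * q.
    by rewrite (lt_le_trans (ltrN10 _))// mulr_ge0// ltW.
  have dq : is_derive x 1 (fun x : R => x * q) q.
    by apply: is_derive_eq; rewrite /GRing.scale/= mulr0 add0r mulr1.
  have dm : is_derive x 1 (memory_profile rho h h1 Phi \o (fun x : R => x * q))
      (memory_slope rho h Phi (x * q) * q).
    by apply: is_derive1_comp; exact: (memory_profile_derive hP).
  have dD : is_derive x 1 (memory_slope rho h Phi \o (fun x : R => x * q))
      (- (drift h h1 (x * q) + 2 * rho * h (x * q)) * q).
    by apply: is_derive1_comp; exact: (memory_slope_derive hP).
  have := dpsi x; have := dpsi1 x => dpsi1x dpsix.
  apply: is_derive_eq.
  rewrite /g memoryE// ger0_norm// -/q /GRing.scale/=.
  have -> : psi1 x * (t `^ a * (memory_slope rho h Phi (x * q) * q)) =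
    (t `^ a * q) * (psi1 x * memory_slope rho h Phi (x * q)) by ring.
  by rewrite Pq; ring.
have ci (F : R -> R) : continuous F -> mu.-integrable `[0, M] (EFin \o F).
  by move=> cF; apply: segment_integrable => x _; exact: cF.
have iA := ci _ cA; have iB := ci _ cB; have iC := ci _ cC.
move: int_g; rewrite /g RintegralD//; last first.
  apply: ci => x.
  by apply: cvgD; (apply: cvgM; first exact: cvg_cst); [exact: cA|exact: cB].
rewrite RintegralD//; [|exact: scaled_integrable..].
by rewrite !RintegralZl// => <-; ring.
Qed.

Lemma profile_satisfies_equation : satisfies_equation alpha rho f (delta 0).
Proof.
move=> t t0 phi /test_function_fold[M [psi1 [psi2]]] /=.
set psi := fun x => phi x + phi (- x).
move=> [[M0 cpsi2] dpsi dpsi1 [psiM [psi1M psi10]] phiE].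
have q0 : 0 < t `^ (- a) by rewrite powR_gt0.
have [|-> _] := phiE _ (dt_continuous t0).
  by move=> x; rewrite !selfsimilar_dt// [- x * _]mulNr (driftN hP).
have [|-> _] := phiE _ (selfsimilar_continuous t0).
  by move=> x; rewrite !fE// [- x * _]mulNr (profileN hP).
have [|_ ->] := phiE _ (memory_continuous t0).
  by move=> x; rewrite !memoryE// normrN.
rewrite (weak_memory t0 M0 dpsi dpsi1)//.
have cpsi : continuous psi by move=> x; exact: is_derive_continuous (dpsi x).
have ci (F : R -> R) : continuous F ->
    mu.-integrable `[0, M] (EFin \o (fun x => F (x * t `^ (- a)) * psi x)).
  move=> cF; apply: segment_integrable => x _; apply: cvgM; last exact: cpsi.
  apply: (@continuous_comp _ _ _ (fun x : R => x * t `^ (- a)) F); last exact: cF.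
  by apply: cvgM; [exact: cvg_id|exact: cvg_cst].
have -> : \int[mu]_(x in `[0, M]) (dt f x t * (phi x + phi (- x))) =
    - a * t `^ (- a - 1) *
    \int[mu]_(x in `[0, M]) (drift h h1 (x * t `^ (- a)) * psi x).
  rewrite -RintegralZl//; last exact: (ci _ (drift_continuous hP)).
  by apply: eq_Rintegral => x _; rewrite selfsimilar_dt// mulrA.
have -> : \int[mu]_(x in `[0, M]) (f x t * (phi x + phi (- x))) =
    t `^ (- a) * \int[mu]_(x in `[0, M]) (h (x * t `^ (- a)) * psi x).
  rewrite -RintegralZl//; last exact: (ci _ (profile_continuous hP)).
  by apply: eq_Rintegral => x _; rewrite fE// mulrA.
set A := \int[_]_(_ in _) _; set B := \int[_]_(_ in _) _.
(* With psi(0) = 2 phi(0), the corner term cancels the initial datum, the two integrals of h cancel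
   each other, and the integrals of k agree because a = alpha / 2. *)
have -> : psi 0 = 2 * phi 0 by rewrite /psi oppr0; ring.
rewrite powR_sub1// /delta alphaE; field; exact: lt0r_neq0.
Qed.

(** * Convergence to the initial datum and decay in space *)

Lemma prim_ndecr (x y : R) : 0 <= x -> x <= y -> Phi x <= Phi y.
Proof.
move=> x0; rewrite le_eqVlt => /predU1P[->//|xy].
rewrite -subr_ge0.
have [||c _ ->] := @MVT _ Phi h x y xy.
- move=> z; rewrite in_itv/= => /andP[xz _]; apply: (profile_prim hP).
  by rewrite (lt_trans (ltrN10 _))// (le_lt_trans x0).
- apply: derivable_within_continuous => z; rewrite in_itv/= => /andP[xz _].
  have /(profile_prim hP)[//] : -1 < z.
  by rewrite (lt_le_trans (ltrN10 _))// (le_trans x0).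
- by rewrite mulr_ge0 ?(profile_ge0 hP)// subr_ge0 ltW.
Qed.

(** [Phi] increases from 0 to its limit 1/2. The bound is uniform in time, which dominated
    convergence as t -> 0 requires. *)
Lemma prim_bound (y : R) : 0 <= y -> `|Phi y - 2^-1| <= 2^-1.
Proof.
move=> y0; have := prim_ndecr (lexx 0) y0; rewrite (profile_prim0 hP) => Phi0.
suff : Phi y <= 2^-1 by rewrite ler_norml => ?; apply/andP; split; lra.
rewrite leNgt; apply/negP => /(cvgr_lt _ (profile_mass hP)) Phi_lt.
have [z [/= zlt yz]] : exists z, [set z | Phi z < Phi y] z /\ y <= z.
  near (pinfty_nbhs R) => z; exists z; split; first by near: z; exact: Phi_lt.
  by near: z; apply: nbhs_pinfty_ge; rewrite num_real.
by have := prim_ndecr y0 yz; rewrite leNgt zlt.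
Unshelve. all: by end_near. Qed.

Lemma prim_scale_derive (q x : R) : 0 <= q -> 0 <= x ->
  is_derive x 1 (fun x : R => Phi (x * q)) (q * h (x * q)).
Proof.
move=> q0 x0; rewrite mulrC.
have dq : is_derive x 1 (fun x : R => x * q) q.
  by apply: is_derive_eq; rewrite /GRing.scale/= mulr0 add0r mulr1.
have : is_derive x 1 (Phi \o (fun x : R => x * q)) (h (x * q) * q).
  apply: is_derive1_comp; apply: (profile_prim hP).
  by rewrite (lt_le_trans (ltrN10 _))// mulr_ge0.
by [].
Qed.

(** Integration by parts against the primitive normalised to vanish at infinity: the boundary term
    is then already the limit phi(0), and the remaining integrand tends to 0 pointwise for x > 0 as
    t -> 0. *)
Lemma selfsimilar_pairing (t M : R) (psi psi1 : R -> R) : 0 < t -> 0 < M ->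
  (forall x : R, is_derive x 1 psi (psi1 x)) -> continuous psi1 -> psi M = 0 ->
  \int[mu]_(x in `[0, M]) (f x t * psi x) = 2^-1 * psi 0 -
  \int[mu]_(x in `[0, M]) ((Phi (x * t `^ (- a)) - 2^-1) * psi1 x).
Proof.
move=> t0 M0 dpsi cpsi1 psiM; set q := t `^ (- a).
have q0 : 0 <= q by exact: powR_ge0.
pose g1 (x : R) := f x t * psi x.
pose g2 (x : R) := (Phi (x * q) - 2^-1) * psi1 x.
have c1 : continuous g1.
  move=> x; apply: cvgM; first exact: selfsimilar_continuous.
  exact: is_derive_continuous (dpsi x).
have c2 x : 0 <= x <= M -> {for x, continuous g2}.
  move=> /andP[x0 _]; apply: cvgM; last exact: cpsi1.
  apply: cvgB; last exact: cvg_cst.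
  exact: is_derive_continuous (prim_scale_derive q0 x0).
have c12 x : 0 <= x <= M -> {for x, continuous (fun x => g1 x + g2 x)}.
  by move=> xM; apply: cvgD; [exact: c1|exact: c2].
have i1 : mu.-integrable `[0, M] (EFin \o g1).
  by apply: segment_integrable => x _; exact: c1.
have i2 : mu.-integrable `[0, M] (EFin \o g2) by exact: segment_integrable.
pose G (x : R) := (Phi (x * q) - 2^-1) * psi x.
have : \int[mu]_(x in `[0, M]) (g1 x + g2 x) = G M - G 0.
  transitivity (fine (G M - G 0)%:E) => //; congr fine.
  apply: (@segment_FTC2 _ _ G 0 M M0); last exact: c12.
  move=> x /andP[x0 _].
  have dP := prim_scale_derive q0 x0; have dpsix := dpsi x.
  apply: is_derive_eq.
  by rewrite /g1 /g2 fE// -/q /GRing.scale/=; ring.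
rewrite RintegralD// => /(canRL (addrK _)); rewrite /g1 => ->.
by rewrite -/(g2 _) /G psiM mul0r (profile_prim0 hP) mulr0; lra.
Qed.

Lemma profile_initial_datum : initial_datum f (delta 0).
Proof.
move=> phi /test_function_fold[M [psi1 [psi2]]] /=.
set psi := fun x => phi x + phi (- x).
move=> [[M0 cpsi2] dpsi dpsi1 [psiM [psi1M psi10]] phiE].
have cpsi1 : continuous psi1 by move=> x; exact: is_derive_continuous (dpsi1 x).
pose g t (x : R) := (Phi (x * t `^ (- a)) - 2^-1) * psi1 x.
have cg t x : 0 <= x <= M -> {for x, continuous (g t)}.
  move=> /andP[x0 _]; apply: cvgM; last exact: cpsi1.
  apply: cvgB; last exact: cvg_cst.
  exact: is_derive_continuous (prim_scale_derive (powR_ge0 _ _) x0).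
have -> : delta 0 phi = 2^-1 * psi 0 - 0.
  by rewrite /delta /psi oppr0; field.
have : 2^-1 * psi 0 - \int[mu]_(x in `[0, M]) g t x @[t --> 0^'+] -->
    2^-1 * psi 0 - 0.
  apply: cvgB; first exact: cvg_cst.
  (* Dominated convergence is a statement about sequences, so the limit t -> 0+ is tested along
     them. *)
  apply/cvg_at_rightP => u [u0 u_cvg].
  have q_cvg : (u n) `^ (- a) @[n --> \oo] --> +oo.
    have u_right : u n @[n --> \oo] --> 0^'+.
      move=> A A0.
      have uA : \forall n \near \oo, 0 < u n -> A (u n) by exact: u_cvg A0.
      suff : \forall n \near \oo, A (u n) by [].
      by apply: filterS uA => n; apply.
    apply: (@cvg_comp _ _ _ u (fun z => z `^ (- a)) _ 0^'+) => //.
    exact: powRN_cvgy.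
  have [|||||_ _ Ig] := @dominated_convergence _ _ _ (@mu R) `[0, M]%classic (measurable_itv _)
    (fun n => EFin \o g (u n)) (EFin \o cst 0)
    (EFin \o (fun x => 2^-1 * `|psi1 x|)).
  - move=> n; apply: measurable_int.
    by apply: segment_integrable => x; exact: cg.
  - by apply/measurable_EFinP.
  - apply/aeW => x; rewrite /= in_itv/= => /andP[x0 _].
    apply: cvg_EFin; first exact: nearW.
    move: x0; rewrite le_eqVlt => /predU1P[<-|x0].
      (* At x = 0 the primitive stays at [Phi 0] instead of tending to 1/2; there the factor psi'(0)
         = 0 gives the limit. *)
      by rewrite /g psi10; under eq_fun do rewrite mulr0; exact: cvg_cst.
    have : g (u n) x @[n --> \oo] --> (2^-1 - 2^-1) * psi1 x.
      apply: cvgM; last exact: cvg_cst.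
      apply: cvgB; last exact: cvg_cst.
      apply: (@cvg_comp _ _ _ (fun n => u n `^ (- a)) (fun q => Phi (x * q))
        _ +oo) => //.
      apply: (@cvg_comp _ _ _ (fun q => x * q) Phi _ +oo).
        by apply: gt0_cvgMry => //; exact: cvg_id.
      exact: (profile_mass hP).
    by rewrite subrr mul0r.
  - apply: segment_integrable => x _; apply: cvgM; first exact: cvg_cst.
    by apply: cvg_norm; exact: cpsi1.
  - apply/aeW => x n; rewrite /= in_itv/= => /andP[x0 _].
    rewrite lee_fin normrM ler_wpM2r//; apply: prim_bound.
    by rewrite mulr_ge0// powR_ge0.
  apply: fine_cvg; move: Ig.
  by rewrite [X in _ --> X -> _]integral0_eq.
apply: cvg_trans; apply: near_eq_cvg; near=> t.
have t0 : 0 < t by near: t; exact: nbhs_right_gt.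
have [|-> _] := phiE _ (selfsimilar_continuous t0).
  by move=> x; rewrite !fE// [- x * _]mulNr (profileN hP).
by rewrite (selfsimilar_pairing t0 M0 dpsi).
Unshelve. all: by end_near. Qed.

Lemma profile_vanishes_at_infinity : vanishes_at_infinity f.
Proof.
move=> t t0.
have fy : f x t @[x --> +oo] --> (0 : R).
  rewrite (_ : f ^~ t = fun x => t `^ (- a) * h (x * t `^ (- a))); last first.
    by apply/funext => x; rewrite fE.
  have : t `^ (- a) * h (x * t `^ (- a)) @[x --> +oo] --> t `^ (- a) * 0.
    apply: cvgM; first exact: cvg_cst.
    apply: (@cvg_comp _ _ _ (fun x : R => x * t `^ (- a)) h _ +oo).
      by apply: gt0_cvgMly; [exact: powR_gt0|exact: cvg_id].
    exact: (profile_cvg0 hP).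
  by rewrite mulr0.
split => //; apply/cvgNy_compNP; move: fy; apply: cvg_trans.
apply: near_eq_cvg; near=> x.
by rewrite /= !fE// mulNr (profileN hP).
Unshelve. all: by end_near. Qed.

End profile_solution.

(** * The beta integral *)

(** By uniqueness of Lebesgue measure it is enough to compare half-open intervals, and the preimage
    of ]a, b] has length (b - a)/w. *)
Lemma lebesgue_measure_affine (R : realType) (w : {nonneg R}) (A : set R) :
  0 < w%:num -> measurable A ->
  (w%:num%:E * (mu : set (measurableTypeR R) -> \bar R)
     ((fun x : R => (w%:num * (x - 1))%R) @^-1` A))%E = mu A.
Proof.
move=> w0 mA; pose phi (x : measurableTypeR R) : measurableTypeR R := w%:num * (x - 1).
have mphi : measurable_fun setT phi.
  by apply: measurable_funM => //; exact: measurable_funB.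
apply/esym.
pose m0 := measure_function_pushforward__canonical__measure_function_Measure mu mphi.
apply: (@lebesgue_measure_unique R (mscale w m0)) => //= _ [[a b]] _ <-.
rewrite /mscale /= /pushforward.
have -> : phi @^-1` `]a, b] = `]1 + a / w%:num, 1 + b / w%:num]%classic.
  by apply/seteqP; split => x; rewrite /phi /= !in_itv/= -ltrBrDl -lerBlDl
    ltr_pdivrMr// ler_pdivlMr// ![(x - 1) * _]mulrC.
rewrite !lebesgue_measure_itv/= !lte_fin ltrD2l ltr_pM2r ?invr_gt0//.
case: ifPn => _; last by rewrite mule0.
by rewrite -!EFinB -EFinM; congr EFin; field; rewrite gt_eqF.
Qed.

(** Done through the image measure, for measurable nonnegative functions, because it serves for the
    Gamma integrand, which is singular at 0. *)
Lemma affine_substitution (R : realType) (w : R) (f : R -> R) : 0 < w ->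
  measurable_fun setT f -> (forall x, 0 < x -> 0 <= f x) ->
  (\int[mu]_(x in `]0%R, +oo[) (f x)%:E =
   w%:E * \int[mu]_(x in `]1%R, +oo[) (f (w * (x - 1)))%:E)%E.
Proof.
move=> w0 mf f0; pose phi (x : measurableTypeR R) : measurableTypeR R := w * (x - 1).
have mphi : measurable_fun setT phi.
  by apply: measurable_funM => //; exact: measurable_funB.
pose m0 := measure_function_pushforward__canonical__measure_function_Measure
  (@mu R) mphi.
pose k := NngNum (ltW w0).
transitivity (\int[mscale k m0]_(x in `]0%R, +oo[) (f x)%:E)%E.
  apply: eq_measure_integral => A mA _.
  exact: esym (@lebesgue_measure_affine R k A w0 mA).
have mfI : measurable_fun (`]0%R, +oo[%classic : set (measurableTypeR R)) (EFin \o f).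
  by apply/measurable_EFinP; exact: measurable_funTS.
rewrite ge0_integral_mscale//; last first.
  by move=> x; rewrite /= in_itv/= andbT lee_fin; exact: f0.
rewrite ge0_integral_pushforward//; last first.
  by move=> x; rewrite inE/= in_itv/= andbT lee_fin; exact: f0.
congr (_ * _)%E; congr integral.
by apply/seteqP; split => x; rewrite /phi /= !in_itv/= !andbT pmulr_rgt0// subr_gt0.
Qed.

(** Multiplying by the two indicators makes the integrand nonnegative on the whole plane, where
    Tonelli's theorem applies. *)
Lemma tonelli_on (R : realType) (A B : set R) (f : R -> R -> R) :
  measurable A -> measurable B ->
  measurable_fun setT (fun z : R * R => f z.1 z.2) ->
  (forall x y, A x -> B y -> 0 <= f x y) ->
  (\int[mu]_(x in A) \int[mu]_(y in B) (f x y)%:E =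
   \int[mu]_(y in B) \int[mu]_(x in A) (f x y)%:E)%E.
Proof.
move=> mA mB mf f0.
pose g (z : R * R) := (\1_A z.1 * (\1_B z.2 * f z.1 z.2))%:E.
have mg : measurable_fun setT g.
  apply/measurable_EFinP; apply: measurable_funM.
    exact: measurableT_comp.
  by apply: measurable_funM => //; exact: measurableT_comp.
have g0 z : (0 <= g z)%E.
  rewrite lee_fin !indicE; case: (boolP (z.1 \in A)) => [/set_mem Az|]; last first.
    by rewrite mul0r.
  case: (boolP (z.2 \in B)) => [/set_mem Bz|]; last by rewrite mul0r mulr0.
  by rewrite !mul1r f0.
have gE := @fubini_tonelli _ _ _ _ R mu mu g mg g0.
have AE (h : R -> \bar R) (D : set R) : (\int[mu]_(x in D) h x =
    \int[mu]_x ((\1_D x)%:E * h x))%E.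
  rewrite integral_mkcond; apply: eq_integral => x _.
  by rewrite patchE indicE; case: ifPn => _; rewrite ?mul1e ?mul0e.
rewrite AE [RHS]AE.
transitivity (\int[mu]_x \int[mu]_y g (x, y))%E.
  apply: eq_integral => x _; rewrite AE indicE.
  case: (boolP (x \in A)) => [/set_mem Ax|xA].
    rewrite mul1e; apply: eq_integral => y _.
    by rewrite /g/= [\1_A x]indicE mem_set// mul1r EFinM.
  rewrite mul0e; apply/esym/integral0_eq => y _.
  by rewrite /g/= [\1_A x]indicE (negbTE xA) mul0r.
rewrite gE; apply: eq_integral => y _; rewrite AE indicE.
case: (boolP (y \in B)) => [/set_mem By|yB].
  rewrite mul1e; apply: eq_integral => x _.
  by rewrite /g/= [\1_B y]indicE mem_set// mul1r EFinM.
rewrite mul0e; apply/integral0_eq => x _.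
by rewrite /g/= [\1_B y]indicE (negbTE yB) mul0r mulr0.
Qed.

(** The shift by 2 matters at n = 0: with a shift by 1 the segment would reduce to the point c +
    1. *)
Lemma ray_exhaustion_lt (R : realType) (c : R) (n : nat) :
  c + n.+2%:R^-1 < c + n.+2%:R.
Proof. by rewrite ltrD2l (@lt_trans _ _ 1) ?invf_lt1 ?ltr1n. Qed.

Lemma ray_exhaustion_sub (R : realType) (c : R) (n : nat) :
  `[c + n.+2%:R^-1, c + n.+2%:R] `<=` `]c, +oo[.
Proof.
move=> x; rewrite /= !in_itv/= andbT => /andP[x1 _].
by rewrite (lt_le_trans _ x1)// ltrDl invr_gt0.
Qed.

Lemma ray_exhaustion_mem (R : realType) (c x : R) : c < x ->
  \forall n \near \oo, c + n.+2%:R^-1 <= x <= c + n.+2%:R.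
Proof.
move=> cx; near=> n.
have xc0 : 0 < x - c by rewrite subr_gt0.
have n1 : (x - c)^-1 <= n%:R by near: n; exact: nbhs_infty_ger.
have n2 : x - c <= n%:R by near: n; exact: nbhs_infty_ger.
have nn : n%:R <= n.+2%:R :> R by rewrite ler_nat -addn2 leq_addr.
apply/andP; split; last by rewrite -lerBlDl (le_trans n2 nn).
by rewrite -lerBrDl -[leRHS]invrK lef_pV2 ?posrE ?invr_gt0// (le_trans n1).
Unshelve. all: by end_near. Qed.

Lemma ray_exhaustion_cvg (R : realType) (c l0 l1 : R) (F : R -> R) :
  F x @[x --> c^'+] --> l0 -> F x @[x --> +oo] --> l1 ->
  F (c + n.+2%:R) - F (c + n.+2%:R^-1) @[n --> \oo] --> l1 - l0.
Proof.
move=> Fl0 Fl1; apply: cvgB.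
- move/cvg_pinftyP : Fl1; apply; apply/cvgryPge => A; near=> n.
  have : A - c <= n%:R by near: n; exact: nbhs_infty_ger.
  have nn : n%:R <= n.+2%:R :> R by rewrite ler_nat -addn2 leq_addr.
  lra.
- move/cvg_at_rightP : Fl0; apply; split; first by move=> n; rewrite ltrDl invr_gt0.
  apply/cvgrPdist_le => e e0; near=> n.
  have n1 : e^-1 <= n%:R by near: n; exact: nbhs_infty_ger.
  have nn : n%:R <= n.+2%:R :> R by rewrite ler_nat -addn2 leq_addr.
  rewrite opprD addNKr normrN gtr0_norm ?invr_gt0//.
  by rewrite -[leRHS]invrK lef_pV2 ?posrE ?invr_gt0// (le_trans n1).
Unshelve. all: by end_near. Qed.

Lemma ray_ge0_integrable (R : realType) (c l0 l1 : R) (f F : R -> R) :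
  (forall x, c < x -> 0 <= f x) ->
  (forall x : R, c < x -> is_derive x 1 F (f x)) ->
  (forall x, c < x -> {for x, continuous f}) ->
  F x @[x --> c^'+] --> l0 -> F x @[x --> +oo] --> l1 ->
  mu.-integrable `]c, +oo[ (EFin \o f).
Proof.
move=> f0 dF cf Fl0 Fl1.
apply: (@ge0_open_FTC2_integrable _ f F _ (fun n => c + n.+2%:R^-1)
  (fun n => c + n.+2%:R) (l1 - l0)).
- exact: interval_open.
- by move=> x; rewrite /= in_itv/= andbT; exact: f0.
- by move=> n; exact: ray_exhaustion_lt.
- by move=> n; exact: ray_exhaustion_sub.
- by move=> x; rewrite /= in_itv/= andbT; exact: ray_exhaustion_mem.
- by move=> x; rewrite /= in_itv/= andbT; exact: dF.
- by move=> x; rewrite /= in_itv/= andbT; exact: cf.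
- exact: ray_exhaustion_cvg.
Qed.

Lemma ray_FTC2 (R : realType) (c l0 l1 : R) (f F : R -> R) :
  (forall x : R, c < x -> is_derive x 1 F (f x)) ->
  (forall x, c < x -> {for x, continuous f}) ->
  F x @[x --> c^'+] --> l0 -> F x @[x --> +oo] --> l1 ->
  mu.-integrable `]c, +oo[ (EFin \o f) ->
  (\int[mu]_(x in `]c, +oo[) (f x)%:E = (l1 - l0)%:E)%E.
Proof.
move=> dF cf Fl0 Fl1 intf.
apply: (@open_FTC2 _ f F _ (fun n => c + n.+2%:R^-1) (fun n => c + n.+2%:R)).
- exact: interval_open.
- by move=> n; exact: ray_exhaustion_lt.
- by move=> n; exact: ray_exhaustion_sub.
- by move=> x; rewrite /= in_itv/= andbT; exact: ray_exhaustion_mem.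
- by move=> x; rewrite /= in_itv/= andbT; exact: dF.
- by move=> x; rewrite /= in_itv/= andbT; exact: cf.
- exact: ray_exhaustion_cvg.
- exact: intf.
Qed.

(** * Exponential and Gamma integrals *)

Lemma expR_scale_continuous (R : realType) (k : R) :
  continuous (fun w : R => expR (- (w * k))).
Proof.
move=> w; apply: (@continuous_comp _ _ _ (fun w : R => - (w * k)) expR).
  by apply: cvgN; apply: cvgM; [exact: cvg_id|exact: cvg_cst].
exact: continuous_expR.
Qed.

Lemma integral_exp_decay (R : realType) (k : R) : 0 < k ->
  (\int[mu]_(w in `]0%R, +oo[) (expR (- (w * k)))%:E = (k^-1)%:E)%E.
Proof.
move=> k0.
pose F (w : R) := - k^-1 * expR (- (w * k)).
have dF (w : R) : 0 < w -> is_derive w 1 F (expR (- (w * k))).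
  move=> _.
  have d1 : is_derive w 1 (fun w : R => - (w * k)) (- k).
    by apply: is_derive_eq; rewrite /GRing.scale/= mulr0 add0r mulr1.
  have d2 : is_derive w 1 (expR \o (fun w : R => - (w * k)))
      (expR (- (w * k)) * - k).
    by apply: is_derive1_comp.
  by apply: is_derive_eq; rewrite /GRing.scale/=; field; rewrite gt_eqF.
have F0 : F w @[w --> 0^'+] --> - k^-1.
  have : F w @[w --> 0^'+] --> F 0.
    apply: cvg_at_right_filter; apply: cvgM; first exact: cvg_cst.
    exact: expR_scale_continuous.
  by rewrite /F mul0r oppr0 expR0 mulr1.
have Fy : F w @[w --> +oo] --> (0 : R).
  have : F w @[w --> +oo] --> - k^-1 * 0.
    apply: cvgM; first exact: cvg_cst.
    apply: (@cvg_comp _ _ _ (fun w : R => w * k) (fun x : R => expR (- x)) _ +oo).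
      by apply: gt0_cvgMly => //; exact: cvg_id.
    exact: cvgr_expR.
  by rewrite mulr0.
have cf (w : R) : 0 < w -> {for w, continuous (fun w : R => expR (- (w * k)))}.
  by move=> _; exact: expR_scale_continuous.
rewrite (@ray_FTC2 _ 0 (- k^-1) 0 _ F)//; first by rewrite sub0r opprK.
by apply: (@ray_ge0_integrable _ 0 (- k^-1) 0 _ F).
Qed.

Definition gamma_integrand (R : realType) (a w : R) : R :=
  expR (- w) * w `^ (a - 1).

Lemma gamma_integrand_continuous (R : realType) (a w : R) : 0 < w ->
  {for w, continuous (gamma_integrand a)}.
Proof.
move=> w0; apply: cvgM.
  apply: (@continuous_comp _ _ _ -%R expR); first exact: opp_continuous.
  exact: continuous_expR.
exact: is_derive_continuous (is_derive1_powR _ w0).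
Qed.

Lemma powR_le_add1 (R : realType) (a w : R) : 0 < a -> a <= 1 -> 0 < w ->
  w `^ a <= 1 + w.
Proof.
move=> a0 a1 w0; have [w1|/ltW w1] := leP w 1.
  apply: (@le_trans _ _ 1); last by rewrite lerDl ltW.
  rewrite -[leRHS](powRr0 w); apply: ger_powR; last exact: ltW.
  by rewrite w0.
by rewrite (le_trans (ler1_powR _ _))// lerDr.
Qed.

Lemma powR_cvgy (R : realType) (a : R) : 0 < a ->
  w `^ a @[w --> +oo] --> (+oo : set_system R).
Proof.
move=> a0; apply/cvgryPge => C; near=> w.
rewrite (le_trans (ler_norm C))//.
have -> : `|C| = (`|C| `^ a^-1) `^ a by rewrite -powRrM mulVf ?gt_eqF// powRr1.
have wC : `|C| `^ a^-1 <= w by near: w; apply: nbhs_pinfty_ge; rewrite num_real.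
by apply: (ge0_ler_powR (ltW a0)); rewrite // nnegrE ?(le_trans _ wC) ?powR_ge0.
Unshelve. all: by end_near. Qed.

(* [w `^ a <= 1 + w] makes [expR (- w)] at most [e * expR (- (w `^ a))], and
   [w `^ (a - 1) * expR (- (w `^ a))] has an explicit primitive. *)
Lemma gamma_integrable (R : realType) (a : R) : 0 < a -> a <= 1 ->
  mu.-integrable `]0%R, +oo[ (EFin \o gamma_integrand a).
Proof.
move=> a0 a1.
pose F (w : R) := - a^-1 * (expR 1 * expR (- (w `^ a))).
pose f (w : R) := expR 1 * (w `^ (a - 1) * expR (- (w `^ a))).
have dF (w : R) : 0 < w -> is_derive w 1 F (f w).
  move=> w0; have dp := is_derive1_powR a w0.
  have d1 : is_derive w 1 (fun w : R => - (w `^ a)) (- (a * w `^ (a - 1))).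
    by apply: is_derive_eq.
  have d2 : is_derive w 1 (expR \o (fun w : R => - (w `^ a)))
      (expR (- (w `^ a)) * - (a * w `^ (a - 1))).
    by apply: is_derive1_comp.
  by apply: is_derive_eq; rewrite /f /GRing.scale/=; field; rewrite gt_eqF.
have cexp (w : R) : 0 < w -> {for w, continuous (fun w : R => expR (- (w `^ a)))}.
  move=> w0; apply: (@continuous_comp _ _ _ (fun w : R => - (w `^ a)) expR).
    by apply: cvgN; exact: is_derive_continuous (is_derive1_powR _ w0).
  exact: continuous_expR.
apply: (@open_dominated_integrable _ _ _ f).
- exact: interval_open.
- move=> w; rewrite /= in_itv/= andbT; exact: gamma_integrand_continuous.
- move=> w; rewrite /= in_itv/= andbT => w0.
  rewrite ger0_norm ?mulr_ge0 ?expR_ge0 ?powR_ge0//.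
  rewrite /f /gamma_integrand mulrCA [leLHS]mulrC ler_wpM2l ?powR_ge0// -expRD ler_expR.
  have := powR_le_add1 a0 a1 w0; lra.
apply: (@ray_ge0_integrable _ 0 (- a^-1 * (expR 1 * expR (- 0)))
  (- a^-1 * (expR 1 * 0)) _ F) => //.
- by move=> w _; rewrite !mulr_ge0 ?expR_ge0 ?powR_ge0.
- move=> w w0; apply: cvgM; first exact: cvg_cst.
  by apply: cvgM; [exact: is_derive_continuous (is_derive1_powR _ w0)|exact: cexp].
- apply: cvgM; first exact: cvg_cst.
  apply: cvgM; first exact: cvg_cst.
  apply: (@cvg_comp _ _ _ (fun w : R => - (w `^ a)) expR _ (nbhs (- 0 : R))).
    by apply: cvgN; exact: powR_cvg0.
  exact: continuous_expR.
- apply: cvgM; first exact: cvg_cst.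
  apply: cvgM; first exact: cvg_cst.
  apply: (@cvg_comp _ _ _ (fun w : R => w `^ a) (fun x : R => expR (- x)) _ +oo).
    exact: powR_cvgy.
  exact: cvgr_expR.
Qed.

Lemma measurable_gamma_integrand (R : realType) (a : R) :
  measurable_fun setT (gamma_integrand a).
Proof.
apply: measurable_funM; last exact: measurable_powR.
by apply: measurableT_comp => //; exact: measurableT_comp.
Qed.

Lemma gamma_integrand_ge0 (R : realType) (a w : R) : 0 <= gamma_integrand a w.
Proof. by rewrite mulr_ge0 ?expR_ge0 ?powR_ge0. Qed.

Lemma integral_gamma_integrand (R : realType) (a : R) : 0 < a -> a <= 1 ->
  (\int[mu]_(w in `]0%R, +oo[) (gamma_integrand a w)%:E = (Gamma a)%:E)%E.
Proof.
move=> a0 a1; rewrite /Gamma /Rintegral fineK//.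
by apply: integrable_fin_num => //; exact: gamma_integrable.
Qed.

Lemma Gamma_gt0 (R : realType) (a : R) : 0 < a -> a <= 1 -> 0 < Gamma a.
Proof.
move=> a0 a1; rewrite -lte_fin -integral_gamma_integrand//.
(* On ]0, 1[ the integrand is at least exp(-1): there exp(-w) >= exp(-1), and w^(a-1) >= 1 because a
   <= 1. *)
apply: (@lt_le_trans _ _ (\int[mu]_(w in `]0%R, 1%R[) (cst (expR (- 1))%:E w))%E).
  rewrite integral_cst//= lebesgue_measure_itv/= lte_fin ltr01 -EFinB subr0.
  by rewrite mule1 lte_fin expR_gt0.
apply: (@le_trans _ _ (\int[mu]_(w in `]0%R, 1%R[) (gamma_integrand a w)%:E)%E).
  apply: ge0_le_integral => //.
  - by move=> w _; rewrite lee_fin expR_ge0.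
  - apply/measurable_EFinP; apply: measurable_funTS.
    exact: measurable_gamma_integrand.
  - move=> w; rewrite /= in_itv/= => /andP[w0 w1]; rewrite lee_fin.
    rewrite -[leLHS]mulr1; apply: ler_pM => //.
      by rewrite ler_expR lerN2 ltW.
    rewrite -[leLHS](powRr0 w); apply: ger_powR; last by rewrite subr_le0.
    by rewrite w0 ltW.
apply: ge0_subset_integral => //.
- apply/measurable_EFinP; apply: measurable_funTS.
  exact: measurable_gamma_integrand.
- by move=> w _; rewrite lee_fin gamma_integrand_ge0.
- by move=> w; rewrite /= !in_itv/= andbT => /andP[].
Qed.

(** The kernel whose iterated integrals are compared by Tonelli: integrating in w on ]0, +oo[ gives
    the beta integrand, integrating in tau on ]1, +oo[ gives a Gamma integrand times Gamma(1 -
    rho). *)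
Definition laplace_kernel (R : realType) (rho w tau : R) : R :=
  expR (- (w * tau)) * (tau - 1) `^ (- rho).

Lemma laplace_kernel_gamma (R : realType) (rho w : R) : 0 < rho < 1 -> 0 < w ->
  (\int[mu]_(tau in `]1%R, +oo[) (laplace_kernel rho w tau)%:E =
   (gamma_integrand rho w)%:E * (Gamma (1 - rho))%:E)%E.
Proof.
move=> /andP[rho0 rho1] w0.
rewrite -integral_gamma_integrand ?subr_gt0 ?gerBl ?(ltW rho0)//.
rewrite (affine_substitution w0)//; last 2 first.
- exact: measurable_gamma_integrand.
- by move=> v _; exact: gamma_integrand_ge0.
have mg : measurable_fun (`]1%R, +oo[%classic : set R)
    (fun tau => (gamma_integrand (1 - rho) (w * (tau - 1)))%:E).
  apply/measurable_EFinP; apply: measurable_funTS.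
  apply: measurableT_comp; first exact: measurable_gamma_integrand.
  by apply: measurable_funM => //; exact: measurable_funB.
rewrite muleA -EFinM -ge0_integralZl//=; last 2 first.
- by move=> tau _; rewrite lee_fin gamma_integrand_ge0.
- by rewrite lee_fin mulr_ge0 ?gamma_integrand_ge0 ?ltW.
apply: eq_integral => tau; rewrite inE/= in_itv/= andbT => tau1.
have tau0 : 0 < tau - 1 by rewrite subr_gt0.
rewrite -EFinM; congr EFin.
rewrite /laplace_kernel /gamma_integrand powRM ?(ltW w0) ?(ltW tau0)//.
have -> : 1 - rho - 1 = - rho by ring.
have -> : - (w * tau) = - w + - (w * (tau - 1)) by ring.
rewrite expRD.
(* The middle w is the Jacobian of v = w (tau - 1); the outer powers come from the Gamma integrands
   of rho in w and of 1 - rho in v. *)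
have pw : w `^ (rho - 1) * w * w `^ (- rho) = 1.
  rewrite -[X in _ * X * _](powRr1 (ltW w0)) -!powRD ?(gt_eqF w0) ?implybT//.
  by rewrite (_ : rho - 1 + 1 - rho = 0) ?powRr0//; ring.
by rewrite -[LHS]mulr1 -[X in _ * X = _]pw; ring.
Qed.

Lemma beta_integral (R : realType) (rho : R) : 0 < rho < 1 ->
  (\int[mu]_(tau in `]1%R, +oo[) ((tau * (tau - 1) `^ rho)^-1)%:E =
   (Gamma rho * Gamma (1 - rho))%:E)%E.
Proof.
move=> rho01; have /andP[rho0 rho1] := rho01.
rewrite EFinM -(integral_gamma_integrand rho0 (ltW rho1)).
have mg : measurable_fun (`]0%R, +oo[%classic : set R)
    (fun w => (gamma_integrand rho w)%:E).
  apply/measurable_EFinP; apply: measurable_funTS.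
  exact: measurable_gamma_integrand.
rewrite -ge0_integralZr//=; last 2 first.
- by move=> w _; rewrite lee_fin gamma_integrand_ge0.
- by rewrite lee_fin ltW// Gamma_gt0 ?subr_gt0 ?gerBl ?ltW.
transitivity (\int[mu]_(w in `]0%R, +oo[) \int[mu]_(tau in `]1%R, +oo[)
    (laplace_kernel rho w tau)%:E)%E; last first.
  apply: eq_integral => w; rewrite inE/= in_itv/= andbT => w0.
  exact: laplace_kernel_gamma.
rewrite tonelli_on//; last 2 first.
- apply: measurable_funM.
    apply: measurableT_comp => //; apply: measurableT_comp => //.
    exact: measurable_funM.
  apply: (@measurableT_comp _ _ _ _ _ _ (fun x : R => x `^ (- rho))) => //.
  exact: measurable_funB.
- by move=> w tau _ _; rewrite mulr_ge0 ?expR_ge0 ?powR_ge0.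
apply: eq_integral => tau; rewrite inE/= in_itv/= andbT => tau1.
have tau0 : 0 < tau by rewrite (lt_trans _ tau1).
under eq_integral do rewrite EFinM.
rewrite ge0_integralZr//=.
- by rewrite integral_exp_decay// -EFinM invfM powRN.
- apply/measurable_EFinP; apply: measurableT_comp => //.
  by apply: measurableT_comp => //; exact: measurable_funM.
- by rewrite lee_fin powR_ge0.
Qed.

(** * Mixtures of exponentials *)

Definition ray1 {R : realType} : set R := `]1%R, +oo[%classic.

(** A Laplace transform in 1/tau. For b = y^2/2 the exponential is that of a centred Gaussian of
    variance tau; in the variable b, differentiation merely divides the weight by - tau. *)
Definition mixture (R : realType) (W : R -> R) (b : R) : R :=
  \int[mu]_(tau in ray1) (W tau * expR (- (b / tau))).

Lemma ray1P (R : realType) (x : R) : ray1 x = (1 < x).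
Proof. by rewrite /ray1 /= in_itv/= andbT. Qed.

Lemma open_ray1 (R : realType) : open (@ray1 R).
Proof. exact: interval_open. Qed.

Lemma measurable_ray1 (R : realType) : measurable (@ray1 R).
Proof. exact: measurable_itv. Qed.

Lemma expR_div_derive (R : realType) (b tau : R) : tau != 0 ->
  is_derive tau 1 (fun tau => expR (- (b / tau)))
    (expR (- (b / tau)) * (b / tau ^+ 2)).
Proof.
move=> tau0.
have d1 : is_derive tau 1 (fun tau : R => - (b / tau)) (b / tau ^+ 2).
  have dV : is_derive tau 1 (fun tau : R => tau^-1) (- tau ^- 2 *: 1).
    exact: (@is_deriveV _ id).
  by apply: is_derive_eq; rewrite /GRing.scale/=; field.
exact: (@is_derive1_comp _ expR (fun tau : R => - (b / tau))).
Qed.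

Section mixture_theory.
Context {R : realType}.
Implicit Types (W : R -> R) (b tau : R).

(** A class stable under division by tau, since tau > 1, so that one differentiation lemma can be
    iterated. *)
Definition weight W := (forall tau, 1 < tau -> {for tau, continuous W}) /\
  mu.-integrable ray1 (EFin \o W).

Lemma weight_divr W : weight W -> weight (fun tau => W tau / tau).
Proof.
move=> [cW iW].
have cWt tau : 1 < tau -> {for tau, continuous (fun tau => W tau / tau)}.
  move=> tau1; apply: cvgM; first exact: cW.
  apply: cvgV; last exact: cvg_id.
  by rewrite gt_eqF// (lt_trans _ tau1).
split => //; apply: (@open_dominated_integrable _ _ _ (fun tau => `|W tau|)).
- exact: open_ray1.
- by move=> tau; rewrite ray1P; exact: cWt.
- move=> tau; rewrite ray1P => tau1 /=; rewrite normrM ler_piMr//.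
  by rewrite ger0_norm ?invr_ge0 ?invf_le1 ?(lt_trans _ tau1)// ltW// (lt_trans _ tau1).
- exact: integrable_abse iW.
Qed.

Lemma expR_div_le b tau : 1 < tau -> expR (- (b / tau)) <= expR `|b|.
Proof.
move=> tau1; rewrite ler_expR (le_trans (ler_norm _))// normrN normrM ler_piMr//.
by rewrite ger0_norm ?invr_ge0 ?invf_le1 ?(lt_trans _ tau1)// ltW// (lt_trans _ tau1).
Qed.

Lemma mixture_continuous W b tau : weight W -> 1 < tau ->
  {for tau, continuous (fun tau => W tau * expR (- (b / tau)))}.
Proof.
move=> [cW _] tau1; apply: cvgM; first exact: cW.
apply: is_derive_continuous (expR_div_derive _ _).
by rewrite gt_eqF// (lt_trans _ tau1).
Qed.

Lemma mixture_integrable W b : weight W ->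
  mu.-integrable ray1 (EFin \o (fun tau => W tau * expR (- (b / tau)))).
Proof.
move=> wW; have [cW iW] := wW.
apply: (@open_dominated_integrable _ _ _ (fun tau => expR `|b| * `|W tau|)).
- exact: open_ray1.
- by move=> tau; rewrite ray1P; exact: mixture_continuous.
- move=> tau; rewrite ray1P => tau1 /=; rewrite normrM mulrC.
  by rewrite ler_wpM2r// ger0_norm ?expR_ge0// expR_div_le.
- apply: scaled_integrable; first exact: measurable_ray1.
  exact: integrable_abse iW.
Qed.

(** Differentiation under the integral sign on a window of radius 1 around b. Negative parameters
    are harmless because tau > 1 bounds exp(-b/tau) by exp |b|; they occur at b = 0, the parameter
    of y = 0, where the derivative is still two-sided. *)
Lemma mixture_derive W b : weight W ->
  is_derive b 1 (mixture W) (- mixture (fun tau => W tau / tau) b).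
Proof.
move=> wW; have [cW iW] := wW.
pose f (x tau : R) := W tau * expR (- (x / tau)).
have df (x tau : R) : is_derive x 1 (f ^~ tau)
    (W tau * (expR (- (x / tau)) * - tau^-1)).
  have d1 : is_derive x 1 (fun x : R => - (x / tau)) (- tau^-1).
    by apply: is_derive_eq; rewrite /GRing.scale/= mulr0 add0r mulr1.
  have d2 : is_derive x 1 (expR \o (fun x : R => - (x / tau)))
      (expR (- (x / tau)) * - tau^-1).
    by apply: is_derive1_comp.
  by apply: is_derive_eq.
have d1f (x tau : R) : partial1of2 f x tau =
    W tau * (expR (- (x / tau)) * - tau^-1).
  by rewrite partial1of2E; have [_ ->] := df x tau.
(* On the window |x| <= |b| + 1, and the factor 1/tau produced by differentiation is at most 1. *)
pose G (tau : R) := expR (`|b| + 1) * `|W tau|.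
have Ib : `]b - 1, b + 1[%classic b by rewrite /= in_itv/= gtrBl ltrDl ltr01.
have intf (x : R) : `]b - 1, b + 1[%classic x -> mu.-integrable ray1 (EFin \o f x).
  by move=> _; exact: mixture_integrable.
have derf (x tau : R) : `]b - 1, b + 1[%classic x -> ray1 tau ->
    derivable (f ^~ tau) x 1.
  by move=> _ _; have [] := df x tau.
have G0 tau : 0 <= G tau by rewrite mulr_ge0 ?expR_ge0.
have iG : mu.-integrable ray1 (EFin \o G).
  apply: scaled_integrable; first exact: measurable_ray1.
  exact: integrable_abse iW.
have Gub (x tau : R) : `]b - 1, b + 1[%classic x -> ray1 tau ->
    `|partial1of2 f x tau| <= G tau.
  rewrite ray1P /= in_itv/= => /andP[x1 x2] tau1.
  rewrite d1f normrM mulrC ler_wpM2r// normrM -[leRHS]mulr1 ler_pM//.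
    rewrite ger0_norm ?expR_ge0// (le_trans (expR_div_le _ tau1))// ler_expR.
    by rewrite ler_norml; have := ler_norm b; have := ler_norm (- b);
      rewrite normrN => ? ?; apply/andP; split; lra.
  by rewrite normrN ger0_norm ?invr_ge0 ?invf_le1 ?(lt_trans _ tau1)// ltW//
    (lt_trans _ tau1).
have mI := @measurable_ray1 R.
have Dmix := @derivable_under_integral R _ _ mu f ray1 mI b _ _ Ib intf derf
  G G0 iG Gub.
have dmix := @differentiation_under_integral R _ _ mu f ray1 mI b _ _ Ib intf derf
  G G0 iG Gub.
apply: DeriveDef; first exact: Dmix.
rewrite -derive1E [LHS]dmix.
rewrite /mixture -mulN1r -RintegralZl//; last first.
  by apply: mixture_integrable; exact: weight_divr.
by apply: eq_Rintegral => tau _; rewrite d1f; ring.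
Qed.

Lemma mixture_ge0 W b : (forall tau, 1 < tau -> 0 <= W tau) -> 0 <= mixture W b.
Proof.
move=> W0; apply: Rintegral_ge0 => tau; rewrite ray1P => tau1.
by rewrite mulr_ge0 ?expR_ge0// W0.
Qed.

Lemma mixture_noninc W b c : weight W -> (forall tau, 1 < tau -> 0 <= W tau) ->
  b <= c -> mixture W c <= mixture W b.
Proof.
move=> wW W0 bc; apply: le_Rintegral.
- exact: measurable_ray1.
- exact: mixture_integrable.
- exact: mixture_integrable.
- move=> tau; rewrite ray1P => tau1; rewrite ler_wpM2l ?W0//.
  by rewrite ler_expR lerN2 ler_wpM2r// invr_ge0 ltW// (lt_trans _ tau1).
Qed.

(** The inequality s exp(-s) <= 1 at s = b/tau. For b = y^2/2 the left side is y h'(y) up to a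
    constant factor, so this yields [profile_bound]. *)
Lemma mixture_divr_bound W b : weight W -> (forall tau, 1 < tau -> 0 <= W tau) ->
  0 <= b -> b * mixture (fun tau => W tau / tau) b <= mixture W 0.
Proof.
move=> wW W0 b0; have wWt := weight_divr wW.
rewrite /mixture -RintegralZl//; last 2 first.
- exact: measurable_ray1.
- exact: mixture_integrable.
apply: le_Rintegral.
- exact: measurable_ray1.
- apply: scaled_integrable; first exact: measurable_ray1.
  exact: mixture_integrable.
- exact: mixture_integrable.
- move=> tau; rewrite ray1P => tau1; rewrite mul0r oppr0 expR0 mulr1.
  have -> : b * (W tau / tau * expR (- (b / tau))) =
      W tau * ((b / tau) / expR (b / tau)) by rewrite expRN; ring.
  rewrite ler_piMr ?W0// ler_pdivrMr ?expR_gt0// mul1r.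
  by rewrite (le_trans _ (expR_ge1Dx _))// lerDr.
Qed.

End mixture_theory.

(** * The mixing weight and its Kummer equation *)

Lemma add_integrable (R : realType) (I : set R) (f g : R -> R) :
  measurable I -> mu.-integrable I (EFin \o f) -> mu.-integrable I (EFin \o g) ->
  mu.-integrable I (EFin \o (fun x => f x + g x)).
Proof.
move=> mI intf intg.
rewrite (_ : _ \o _ = ((EFin \o f) \+ (EFin \o g))%E)//.
exact: integrableD.
Qed.

(** On tau > 1 this is tau^(-1/2) l_rho(tau) without its Gamma factors: the square root of the
    Gaussian normalisation is absorbed into the mixing density. *)
Definition wmix (R : realType) (rho tau : R) : R :=
  tau `^ (- (3 / 2)) * (tau - 1) `^ (- rho).

Lemma powR_subr_derive (R : realType) (c tau : R) : 1 < tau ->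
  is_derive tau 1 (fun tau : R => (tau - 1) `^ c) (c * (tau - 1) `^ (c - 1)).
Proof.
move=> tau1; have t0 : 0 < tau - 1 by rewrite subr_gt0.
have dp := is_derive1_powR c t0.
have d1 : is_derive tau 1 (fun tau : R => tau - 1) 1.
  by apply: is_derive_eq; rewrite subr0.
have := @is_derive1_comp _ (fun x : R => x `^ c) (fun tau : R => tau - 1) tau _ _ dp d1.
by rewrite mulr1.
Qed.

Lemma wmix_ge0 (R : realType) (rho tau : R) : 0 <= wmix rho tau.
Proof. by rewrite mulr_ge0 ?powR_ge0. Qed.

Lemma wmixE (R : realType) (rho tau : R) : 1 < tau ->
  wmix rho tau = tau `^ (- 2^-1) * (tau * (tau - 1) `^ rho)^-1.
Proof.
move=> tau1; have t0 : 0 < tau by rewrite (lt_trans _ tau1).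
rewrite /wmix (_ : - (3 / 2) = - 2^-1 - 1 :> R); last by field.
by rewrite powR_sub1// powRN invfM mulrA.
Qed.

Lemma powR_le1 (R : realType) (c tau : R) : 0 <= c -> 1 <= tau -> tau `^ (- c) <= 1.
Proof.
move=> c0 tau1; rewrite -[leRHS](powRr0 tau); apply: ler_powR => //.
by rewrite oppr_le0.
Qed.

Lemma measurable_beta_density (R : realType) (rho : R) :
  measurable_fun ray1 (fun tau => (tau * (tau - 1) `^ rho)^-1).
Proof.
apply: open_continuous_measurable_fun; first exact: open_ray1.
move=> tau; rewrite inE ray1P => tau1; apply: cvgV.
  by rewrite gt_eqF// mulr_gt0 ?powR_gt0 ?subr_gt0// (lt_trans _ tau1).
apply: cvgM; first exact: cvg_id.
exact: is_derive_continuous (powR_subr_derive _ tau1).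
Qed.

(** As tau^(-1/2) <= 1 on the ray, the weight is dominated by the beta integrand, whose integral has
    been computed and is finite. *)
Lemma weight_wmix (R : realType) (rho : R) : 0 < rho < 1 -> weight (wmix rho).
Proof.
move=> rho01.
have cw tau : 1 < tau -> {for tau, continuous (wmix rho)}.
  move=> tau1; apply: cvgM.
    by apply: is_derive_continuous (is_derive1_powR _ _); rewrite (lt_trans _ tau1).
  exact: is_derive_continuous (powR_subr_derive _ tau1).
split => //.
apply: (@open_dominated_integrable _ _ _ (fun tau => (tau * (tau - 1) `^ rho)^-1)).
- exact: open_ray1.
- by move=> tau; rewrite ray1P; exact: cw.
- move=> tau; rewrite ray1P => tau1.
  rewrite ger0_norm ?wmix_ge0// wmixE// ler_piMl//.
    by rewrite invr_ge0 mulr_ge0 ?powR_ge0// ltW// (lt_trans _ tau1).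
  by apply: powR_le1; rewrite ?ltW.
apply/integrableP; split.
  by apply/measurable_EFinP; exact: measurable_beta_density.
rewrite (_ : (\int[mu]_(x in _) _)%E = (Gamma rho * Gamma (1 - rho))%:E) ?ltry//.
rewrite -beta_integral//; apply: eq_integral => tau; rewrite inE ray1P => tau1 /=.
by rewrite ger0_norm// invr_ge0 mulr_ge0 ?powR_ge0// ltW// (lt_trans _ tau1).
Qed.

(* The integrand of this combination is the derivative of
   [-2 tau^(-3/2) (tau - 1)^(1 - rho) exp (-b/tau)], which vanishes at both
   ends of the ray. *)
Lemma mixture_kummer (R : realType) (rho b : R) : 0 < rho < 1 -> 0 <= b ->
  2 * b * mixture (fun tau => wmix rho tau / tau / tau) b
  - (3 + 2 * b) * mixture (fun tau => wmix rho tau / tau) b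
  + (1 + 2 * rho) * mixture (wmix rho) b = 0.
Proof.
move=> rho01 b0; have /andP[rho0 rho1] := rho01.
have w0 := weight_wmix rho01; have w1 := weight_divr w0; have w2 := weight_divr w1.
have i0 := mixture_integrable b w0; have i1 := mixture_integrable b w1.
have i2 := mixture_integrable b w2.
have mr := @measurable_ray1 R.
pose W0 tau := wmix rho tau * expR (- (b / tau)).
pose W1 tau := wmix rho tau / tau * expR (- (b / tau)).
pose W2 tau := wmix rho tau / tau / tau * expR (- (b / tau)).
pose g tau := 2 * b * W2 tau + (- (3 + 2 * b) * W1 tau + (1 + 2 * rho) * W0 tau).
have s0 := scaled_integrable (1 + 2 * rho) mr i0.
have s1 := scaled_integrable (- (3 + 2 * b)) mr i1.
have s2 := scaled_integrable (2 * b) mr i2.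
have s01 : mu.-integrable ray1
    (EFin \o (fun tau => - (3 + 2 * b) * W1 tau + (1 + 2 * rho) * W0 tau)).
  exact: add_integrable mr s1 s0.
have ig : mu.-integrable ray1 (EFin \o g) by exact: add_integrable mr s2 s01.
suff : \int[mu]_(tau in ray1) g tau = 0.
  rewrite /g RintegralD// RintegralD// !RintegralZl// => <-.
  by rewrite /mixture /W0 /W1 /W2; ring.
pose Q (tau : R) := - 2 * (tau `^ (- (3 / 2)) * (tau - 1) `^ (1 - rho) *
  expR (- (b / tau))).
transitivity (fine (0 - 0 : R)%:E); last by rewrite subr0.
congr fine; apply: (@ray_FTC2 _ 1 0 0 g Q).
- move=> tau tau1; have t0 : 0 < tau by rewrite (lt_trans _ tau1).
  have dp := is_derive1_powR (- (3 / 2)) t0.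
  have dq := powR_subr_derive (1 - rho) tau1.
  have de := @expR_div_derive R b tau (lt0r_neq0 t0).
  apply: is_derive_eq.
  rewrite /g /W0 /W1 /W2 /wmix /GRing.scale/=.
  rewrite (_ : 1 - rho - 1 = - rho); last by ring.
  rewrite powR_sub1//.
  rewrite (_ : 1 - rho = - rho + 1); last by ring.
  rewrite powRD ?(gt_eqF (_ : 0 < tau - 1)) ?subr_gt0 ?implybT//.
  rewrite powRr1 ?subr_ge0 ?ltW//.
  by field; rewrite gt_eqF.
- move=> tau tau1.
  apply: cvgD; first by apply: cvgM; [exact: cvg_cst|exact: mixture_continuous w2 tau1].
  by apply: cvgD; (apply: cvgM; first exact: cvg_cst);
    [exact: mixture_continuous w1 tau1|exact: mixture_continuous w0 tau1].
- have : Q tau @[tau --> 1^'+] --> - 2 * (1 `^ (- (3 / 2)) * 0 * expR (- (b / 1))).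
    apply: cvgM; first exact: cvg_cst.
    apply: cvgM; last first.
      apply: cvg_at_right_filter.
      exact: is_derive_continuous (expR_div_derive b (oner_neq0 R)).
    apply: cvgM.
      apply: cvg_at_right_filter.
      exact: is_derive_continuous (is_derive1_powR _ ltr01).
    apply/cvg_at_rightP => u [u1 u_cvg].
    have /cvg_at_rightP : x `^ (1 - rho) @[x --> 0^'+] --> (0 : R).
      by apply: powR_cvg0; rewrite subr_gt0.
    apply; split; first by move=> n; rewrite subr_gt0.
    by rewrite -(subrr (1 : R)); apply: cvgB => //; exact: cvg_cst.
  by rewrite mulr0 mul0r mulr0.
- apply: norm_cvg0.
  (* For tau > 1, (tau - 1)^(1 - rho) <= tau^(1 - rho) <= tau and the exponential is at most 1, so
     |Q| <= 2 tau^(-3/2) tau. *)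
  apply: (@squeeze_cvgr _ _ _ _ (cst 0) (fun tau => 2 * (tau `^ 2^-1)^-1)).
  + near=> tau.
    have tau1 : 1 < tau by near: tau; apply: nbhs_pinfty_gt; rewrite num_real.
    have t0 : 0 < tau by rewrite (lt_trans _ tau1).
    rewrite normr_ge0/= /Q mulNr normrN ger0_norm ?mulr_ge0 ?powR_ge0 ?expR_ge0//.
    rewrite -powRN; apply: ler_wpM2l => //.
    have -> : tau `^ (- 2^-1) = tau `^ (- (3 / 2)) * tau * 1.
      rewrite -{3}(powRr1 (ltW t0)) -powRD ?(gt_eqF t0) ?implybT// mulr1.
      by congr powR; field.
    rewrite ler_pM ?mulr_ge0 ?powR_ge0 ?expR_ge0//.
      rewrite ler_wpM2l ?powR_ge0//.
      apply: (@le_trans _ _ (tau `^ (1 - rho))).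
        have r1 : 0 <= 1 - rho by rewrite subr_ge0 ltW.
        apply: (ge0_ler_powR r1); last by rewrite gerBl.
          by rewrite nnegrE subr_ge0 ltW.
        by rewrite nnegrE ltW.
      by apply: ler1_powR; [exact: ltW|rewrite gerBl ltW].
    by rewrite expR_le1 oppr_le0 divr_ge0// ltW.
  + exact: cvg_cst.
  + rewrite -(mulr0 2); apply: cvgM; first exact: cvg_cst.
    apply: (@cvg_comp _ _ _ (fun tau : R => tau `^ 2^-1) (fun x : R => x^-1) _ +oo).
      exact: powR_cvgy.
    exact: inv_cvgy0.
- exact: ig.
Unshelve. all: by end_near. Qed.

(** * The profile of the grey Brownian motion *)

Lemma gaussian_continuous (R : realType) (tau : R) :
  continuous (fun y : R => expR (- (y ^+ 2 / 2 / tau))).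
Proof.
move=> y; apply: (@continuous_comp _ _ _ (fun y : R => - (y ^+ 2 / 2 / tau)) expR).
  apply: cvgN; apply: cvgM; last exact: cvg_cst.
  by apply: cvgM; [exact: exprn_continuous|exact: cvg_cst].
exact: continuous_expR.
Qed.

Lemma half_gaussian_integral (R : realType) (tau : R) : 0 < tau ->
  (\int[mu]_(y in `[0%R, +oo[) (expR (- (y ^+ 2 / 2 / tau)))%:E =
   (Num.sqrt (2 * pi * tau) / 2)%:E)%E.
Proof.
move=> tau0; set c := Num.sqrt _; pose E (y : R) := expR (- (y ^+ 2 / 2 / tau)).
have c0 : 0 < c by rewrite sqrtr_gt0 !mulr_gt0 ?pi_gt0.
have s0 : Num.sqrt tau != 0 by rewrite gt_eqF// sqrtr_gt0.
have cE : continuous E by exact: gaussian_continuous.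
have mE : measurable_fun setT (EFin \o E).
  by apply/measurable_EFinP; exact: continuous_measurable_fun.
have pdfE : (\int[mu]_y (normal_pdf 0 (Num.sqrt tau) y)%:E =
    \int[mu]_y ((c^-1)%:E * (E y)%:E))%E.
  apply: eq_integral => y _.
  rewrite /normal_pdf (negbTE s0) /normal_peak /normal_fun.
  rewrite sqr_sqrtr ?ltW// subr0 -EFinM; congr EFin.
  congr (_^-1 * expR _); last by rewrite -mulr_natr; field; rewrite gt_eqF.
  by congr Num.sqrt; rewrite -mulr_natr; ring.
have := @integral_normal_pdf R 0 (Num.sqrt tau); rewrite pdfE.
rewrite ge0_integralZl//; last 2 first.
- by move=> y _; rewrite lee_fin expR_ge0.
- by rewrite lee_fin invr_ge0 ltW.
rewrite ge0_symfun_integralT//; last 2 first.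
- by move=> y; exact: expR_ge0.
- by move=> y; rewrite /E /= sqrrN.
rewrite -set_itvcy muleA -EFinM => cI.
(* [cI] says that (2/c) times the half-line integral is 1; inserting (c/2) (2/c) isolates that
   integral. *)
rewrite -[LHS]mul1e -[X in (X * _ = _)%E](_ : ((c / 2)%:E * (c^-1 * 2)%:E = 1)%E).
  by rewrite -muleA cI mule1.
by rewrite -EFinM; congr EFin; field; rewrite gt_eqF.
Qed.

Lemma primitive_exists (R : realType) (h : R -> R) (l : R) : continuous h ->
  (forall y, 0 <= h y) ->
  (\int[mu]_(y in `[0%R, +oo[) (h y)%:E = l%:E)%E ->
  exists Phi : R -> R, [/\ forall y : R, -1 < y -> is_derive y 1 Phi (h y),
    Phi 0 = 0 & Phi y @[y --> +oo] --> l].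
Proof.
move=> ch h0 hl.
(* The base point -1 gives a two-sided derivative at 0; the normalisation at 0 is restored by
   subtracting [Psi 0]. *)
pose Psi (y : R) := \int[mu]_(x in `[-1, y]) h x.
have dPsi (y : R) : -1 < y -> is_derive y 1 Psi (h y).
  move=> y1; have yy : y < y + 1 by rewrite ltrDl.
  have ih : mu.-integrable `[-1, y + 1] (EFin \o h).
    by apply: segment_integrable => x _; exact: ch.
  have [D1 D2] := continuous_FTC1_closed yy ih y1 (ch y).
  by apply: DeriveDef; [exact: D1|rewrite -derive1E; exact: D2].
have dPhi (y : R) : -1 < y -> is_derive y 1 (fun y : R => Psi y - Psi 0) (h y).
  by move=> y1; have d1 := dPsi y y1; apply: is_derive_eq; rewrite subr0.
exists (fun y => Psi y - Psi 0); split; [exact: dPhi|by rewrite subrr|].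
apply/cvg_pinftyP => u u_cvg.
have ih : mu.-integrable `[0, +oo[ (EFin \o h).
  apply/integrableP; split.
    apply/measurable_EFinP; apply: measurable_funTS.
    exact: continuous_measurable_fun.
  rewrite (_ : (\int[mu]_(x in _) _)%E = l%:E) ?ltry// -hl.
  by apply: eq_integral => x _ /=; rewrite ger0_norm.
pose J : set R := `[0, +oo[%classic.
have mh : measurable_fun J h by case/integrableP : ih => /measurable_EFinP.
have mJ : measurable J by exact: measurable_itv.
have [|||||_ _ If] := @dominated_convergence _ _ _ (@mu R) J mJ
  (fun n => EFin \o (h \_ `[0, u n])) (EFin \o h) (EFin \o h).
- move=> n; apply/measurable_EFinP.
  exact: (@exhaustion_measurable _ _ _ (fun _ => 0) u).
- exact/measurable_EFinP.
- apply/aeW => x; rewrite /J /= in_itv/= andbT => x0.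
  apply: (@exhaustion_pointwise _ _ (fun _ => 0) u); near=> n.
  by rewrite x0/=; near: n; move/cvgryPge : u_cvg; exact.
- exact: ih.
- apply/aeW => x n _ /=; rewrite lee_fin patchE; case: ifP => _.
    by rewrite ger0_norm.
  by rewrite normr0.
have : fine (\int[mu]_(x in J) ((h \_ `[0, u n]) x)%:E)%E @[n --> \oo] --> l.
  by apply: fine_cvg; rewrite -hl.
apply: cvg_trans; apply: near_eq_cvg; near=> n.
have un0 : 0 < u n.
  by near: n; move/cvgryPgt : u_cvg; exact.
apply/esym; transitivity (fine (\int[mu]_(x in `[0%R, u n]) (h x)%:E)%E).
  have -> : Psi (u n) - Psi 0 = fine (Psi (u n) - Psi 0)%:E by [].
  congr fine; apply/esym; apply: segment_FTC2 un0 _ _ => x /andP[x0 _].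
    by apply: dPsi; rewrite (lt_le_trans _ x0).
  exact: ch.
congr fine; apply/esym.
transitivity (\int[mu]_(x in J) ((EFin \o h) \_ `[0%R, u n]) x)%E.
  by apply: eq_integral => x _; rewrite restrict_EFin.
rewrite -integral_mkcondr setIidr// /J => x.
by rewrite /= !in_itv/= andbT => /andP[].
Unshelve. all: by end_near. Qed.

Lemma half_sqr_derive (R : realType) (y : R) : is_derive y 1 (fun y : R => y ^+ 2 / 2) y.
Proof. by apply: is_derive_eq; rewrite /GRing.scale/=; field. Qed.

Lemma measurable_gaussian (R : realType) (tau : R) (D : set (measurableTypeR R)) :
  measurable_fun D (fun y : R => (expR (- (y ^+ 2 / 2 / tau)))%:E).
Proof.
apply/measurable_EFinP; apply: measurable_funTS.
by apply: continuous_measurable_fun; exact: gaussian_continuous.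
Qed.

Section mixture_profile.
Context {R : realType}.
Variables (rho C : R).
Hypothesis rho01 : 0 < rho < 1.
Hypothesis C0 : 0 <= C.

Let w1 (tau : R) := wmix rho tau / tau.
Let w2 (tau : R) := w1 tau / tau.
Let h (y : R) := C * mixture (wmix rho) (y ^+ 2 / 2).
Let h1 (y : R) := - (C * y * mixture w1 (y ^+ 2 / 2)).
Let h2 (y : R) := C * (y ^+ 2 * mixture w2 (y ^+ 2 / 2) - mixture w1 (y ^+ 2 / 2)).

Lemma mixture_sqr_derive (W : R -> R) (y : R) : weight W ->
  is_derive y 1 (fun y : R => mixture W (y ^+ 2 / 2))
    (- mixture (fun tau => W tau / tau) (y ^+ 2 / 2) * y).
Proof.
move=> wW; have d1 := mixture_derive (y ^+ 2 / 2) wW.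
exact: (@is_derive1_comp _ (mixture W) (fun y : R => y ^+ 2 / 2) y _ _ d1
  (half_sqr_derive y)).
Qed.

Lemma mixture_profile_derive1 (y : R) : is_derive y 1 h (h1 y).
Proof.
have d := mixture_sqr_derive y (weight_wmix rho01).
by apply: is_derive_eq; rewrite /h1 /w1 /GRing.scale/=; ring.
Qed.

Lemma mixture_profile_derive2 (y : R) : is_derive y 1 h1 (h2 y).
Proof.
have d := mixture_sqr_derive y (weight_divr (weight_wmix rho01)).
by apply: is_derive_eq; rewrite /h2 /w2 /w1 /GRing.scale/=; ring.
Qed.

Lemma mixture_profile_continuous : continuous h.
Proof. by move=> y; exact: is_derive_continuous (mixture_profile_derive1 y). Qed.

Lemma mixture_profile_ge0 (y : R) : 0 <= h y.
Proof. by rewrite mulr_ge0// mixture_ge0// => tau _; exact: wmix_ge0. Qed.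

(** After exchanging the integrals, the Gaussian one contributes sqrt(tau), which cancels the
    tau^(-1/2) of the weight and leaves the beta integrand. *)
Lemma mixture_profile_mass :
  (\int[mu]_(y in `[0%R, +oo[) (h y)%:E =
   (C * (Num.sqrt (2 * pi) / 2 * (Gamma rho * Gamma (1 - rho))))%:E)%E.
Proof.
(* The inverse is written as a power so that joint measurability on the plane follows from that of
   power functions; the two agree for tau > 1. *)
pose K (y tau : R) := wmix rho tau * expR (- (y ^+ 2 / 2 * tau `^ (-1))).
have mr := @measurable_ray1 R.
have mJ : measurable (`[0%R, +oo[%classic : set (measurableTypeR R)) by exact: measurable_itv.
have w0 := weight_wmix rho01.
have KE (y tau : R) : 1 < tau -> K y tau = wmix rho tau * expR (- (y ^+ 2 / 2 / tau)).
  by move=> tau1; rewrite /K powR_inv1// ltW// (lt_trans _ tau1).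
have mK : measurable_fun setT (fun z : R * R => K z.1 z.2).
  apply: measurable_funM.
    apply: measurable_funM.
      exact: (@measurableT_comp _ _ _ _ _ _ (fun x : R => x `^ (- (3 / 2)))).
    apply: (@measurableT_comp _ _ _ _ _ _ (fun x : R => x `^ (- rho))) => //.
    exact: measurable_funB.
  apply: measurableT_comp => //; apply: measurableT_comp => //.
  apply: measurable_funM.
    by apply: measurable_funM => //; exact: measurable_funX.
  exact: (@measurableT_comp _ _ _ _ _ _ (fun x : R => x `^ (-1))).
have K0 (y tau : R) : 0 <= K y tau by rewrite mulr_ge0 ?wmix_ge0 ?expR_ge0.
pose m (y : R) := mixture (wmix rho) (y ^+ 2 / 2).
have mE (y : R) : ((m y)%:E = \int[mu]_(tau in ray1) (K y tau)%:E)%E.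
  rewrite /m /mixture /Rintegral fineK.
    by apply: eq_integral => tau; rewrite inE ray1P => /KE ->.
  by apply: integrable_fin_num => //; exact: mixture_integrable.
have cm : continuous m.
  by move=> y; exact: is_derive_continuous (mixture_sqr_derive y w0).
have mm : measurable_fun (`[0%R, +oo[%classic : set (measurableTypeR R)) (EFin \o m).
  by apply/measurable_EFinP; apply: measurable_funTS; exact: continuous_measurable_fun.
have mb : measurable_fun ray1 (fun tau => ((tau * (tau - 1) `^ rho)^-1)%:E).
  by apply/measurable_EFinP; exact: measurable_beta_density.
transitivity (C%:E * \int[mu]_(y in `[0%R, +oo[) (m y)%:E)%E.
  transitivity (\int[mu]_(y in `[0%R, +oo[) (C%:E * (m y)%:E))%E; first by [].
  apply: (ge0_integralZl _ mJ mm); last by rewrite lee_fin.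
  by move=> y _; rewrite lee_fin mixture_ge0// => tau _; exact: wmix_ge0.
rewrite EFinM; congr (_ * _)%E.
transitivity (\int[mu]_(y in `[0%R, +oo[) \int[mu]_(tau in ray1) (K y tau)%:E)%E.
  by apply: eq_integral => y _; exact: mE.
rewrite tonelli_on//.
have c20 : (0 <= (Num.sqrt (2 * pi) / 2 : R)%:E)%E.
  by rewrite lee_fin divr_ge0// sqrtr_ge0.
rewrite EFinM -beta_integral// -ge0_integralZl//; last first.
  move=> tau; rewrite /= in_itv/= andbT => tau1.
  by rewrite lee_fin invr_ge0 mulr_ge0 ?powR_ge0// ltW// (lt_trans _ tau1).
apply: eq_integral => tau; rewrite inE ray1P => tau1.
have tau0 : 0 < tau by rewrite (lt_trans _ tau1).
transitivity ((wmix rho tau)%:E *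
    \int[mu]_(y in `[0%R, +oo[) (expR (- (y ^+ 2 / 2 / tau)))%:E)%E.
  transitivity (\int[mu]_(y in `[0%R, +oo[) ((wmix rho tau)%:E *
      (expR (- (y ^+ 2 / 2 / tau)))%:E))%E.
    by apply: eq_integral => y _; rewrite KE// EFinM.
  apply: (ge0_integralZl _ mJ (@measurable_gaussian R tau _)).
    by move=> y _; rewrite lee_fin expR_ge0.
  by rewrite lee_fin wmix_ge0.
rewrite half_gaussian_integral// wmixE// -!EFinM; congr EFin.
rewrite sqrtrM ?mulr_ge0 ?pi_ge0//.
have -> : tau `^ (- 2^-1) = (Num.sqrt tau)^-1 by rewrite powRN powR12_sqrt// ltW.
set P := (tau * _)^-1.
by field; rewrite gt_eqF// sqrtr_gt0.
Qed.

Lemma mixture_profile :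
  C * (Num.sqrt (2 * pi) / 2 * (Gamma rho * Gamma (1 - rho))) = 2^-1 ->
  exists Phi, profile rho h h1 h2 Phi.
Proof.
move=> CE; have := mixture_profile_mass; rewrite CE => hmass.
have [Phi [dPhi Phi0 Phiy]] :=
  primitive_exists mixture_profile_continuous mixture_profile_ge0 hmass.
have w0 := weight_wmix rho01.
exists Phi; split.
- by move=> y; rewrite /h sqrrN.
- exact: mixture_profile_ge0.
- move=> x y x0 xy; rewrite /h ler_wpM2l// mixture_noninc//.
    by move=> tau _; exact: wmix_ge0.
  by rewrite ler_wpM2r// ler_pXn2r// nnegrE (le_trans x0).
- exact: mixture_profile_derive1.
- exact: mixture_profile_derive2.
- move=> y; have b0 : 0 <= y ^+ 2 / 2 by rewrite divr_ge0// sqr_ge0.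
  have : 2 * (y ^+ 2 / 2) * mixture w2 (y ^+ 2 / 2)
      - (3 + 2 * (y ^+ 2 / 2)) * mixture w1 (y ^+ 2 / 2)
      + (1 + 2 * rho) * mixture (wmix rho) (y ^+ 2 / 2) = 0.
    exact: mixture_kummer.
  rewrite /h /h1 /h2; set m0 := mixture (wmix rho) _.
  set m1 := mixture w1 _; set m2 := mixture w2 _ => kummer.
  (* At b = y^2/2 the profile equation is C y times Kummer's equation: the - (3 + 2 b) collects - 1
     from h'' and - (2 + y^2) from the coefficient of h'. *)
  transitivity (C * y * (2 * (y ^+ 2 / 2) * m2 - (3 + 2 * (y ^+ 2 / 2)) * m1
    + (1 + 2 * rho) * m0)); last by rewrite kummer mulr0.
  by field.
- exists (C * (2 * mixture (wmix rho) 0)) => y.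
  have b0 : 0 <= y ^+ 2 / 2 by rewrite divr_ge0// sqr_ge0.
  have := mixture_divr_bound w0 (fun tau _ => wmix_ge0 rho tau) b0.
  rewrite -/w1 => bound.
  have m10 : 0 <= mixture w1 (y ^+ 2 / 2).
    by apply: mixture_ge0 => tau tau1; rewrite divr_ge0 ?wmix_ge0// ltW// (lt_trans _ tau1).
  have -> : y * h1 y = - (C * (2 * (y ^+ 2 / 2 * mixture w1 (y ^+ 2 / 2)))).
    by rewrite /h1; field.
  rewrite normrN ger0_norm; last first.
    exact: (mulr_ge0 C0 (mulr_ge0 (ler0n _ 2) (mulr_ge0 b0 m10))).
  exact: (ler_wpM2l C0 (ler_wpM2l (ler0n _ 2) bound)).
- exact: dPhi.
- exact: Phi0.
- exact: Phiy.
Qed.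

End mixture_profile.

(** For rho = 1 the mixing law is the Dirac mass at 1, so the profile is the standard normal
    density. It satisfies h' = - y h, which makes the profile equation a polynomial identity. *)
Lemma gaussian_profile (R : realType) :
  exists (h1 h2 Phi : R -> R),
  profile 1 (fun y : R => (Num.sqrt (2 * pi))^-1 * expR (- (y ^+ 2 / 2))) h1 h2 Phi.
Proof.
set C := (Num.sqrt (2 * pi))^-1.
have c0 : 0 < Num.sqrt (2 * pi : R) by rewrite sqrtr_gt0 mulr_gt0 ?pi_gt0.
have C0 : 0 <= C by rewrite invr_ge0 ltW.
pose h (y : R) := C * expR (- (y ^+ 2 / 2)).
have de (y : R) : is_derive y 1 (fun y : R => expR (- (y ^+ 2 / 2)))
    (expR (- (y ^+ 2 / 2)) * - y).
  have d1 := half_sqr_derive y.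
  have d2 : is_derive y 1 (fun y : R => - (y ^+ 2 / 2)) (- y) by apply: is_derive_eq.
  exact: (@is_derive1_comp _ expR (fun y : R => - (y ^+ 2 / 2))).
have dh (y : R) : is_derive y 1 h (- (y * h y)).
  by have d := de y; apply: is_derive_eq; rewrite /h /GRing.scale/=; ring.
have dh1 (y : R) : is_derive y 1 (fun y => - (y * h y)) ((y ^+ 2 - 1) * h y).
  by have d := dh y; apply: is_derive_eq; rewrite /GRing.scale/=; ring.
have ch : continuous h by move=> y; exact: is_derive_continuous (dh y).
have h0 (y : R) : 0 <= h y by rewrite mulr_ge0 ?expR_ge0.
have hmass : (\int[mu]_(y in `[0%R, +oo[) (h y)%:E = (2^-1)%:E)%E.
  transitivity (C%:E *
      \int[mu]_(y in `[0%R, +oo[) (expR (- (y ^+ 2 / 2 / 1)))%:E)%E.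
    transitivity (\int[mu]_(y in `[0%R, +oo[) (C%:E *
        (expR (- (y ^+ 2 / 2 / 1)))%:E))%E.
      by apply: eq_integral => y _; rewrite divr1 EFinM.
    have mJ : measurable (`[0%R, +oo[%classic : set (measurableTypeR R)).
      exact: measurable_itv.
    apply: (ge0_integralZl _ mJ (@measurable_gaussian R 1 _)).
      by move=> y _; rewrite lee_fin expR_ge0.
    by rewrite lee_fin.
  by rewrite half_gaussian_integral// -EFinM mulr1; congr EFin; rewrite /C; field; rewrite gt_eqF.
have [Phi [dPhi Phi0 Phiy]] := primitive_exists ch h0 hmass.
exists (fun y => - (y * h y)), (fun y => (y ^+ 2 - 1) * h y), Phi; split.
- by move=> y; rewrite sqrrN.
- exact: h0.
- move=> x y x0 xy; rewrite ler_wpM2l// ler_expR lerN2.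
  by rewrite ler_wpM2r// ler_pXn2r// nnegrE (le_trans x0).
- exact: dh.
- exact: dh1.
- by move=> y; rewrite /h; ring.
- exists (2 * C) => y.
  have b0 : 0 <= y ^+ 2 / 2 by rewrite divr_ge0// sqr_ge0.
  have e0 := expR_gt0 (y ^+ 2 / 2).
  have -> : y * - (y * h y) = - (2 * C * (y ^+ 2 / 2 / expR (y ^+ 2 / 2))).
    by rewrite /h expRN; field; rewrite gt_eqF.
  have C2 : 0 <= 2 * C by rewrite mulr_ge0.
  have r0 : 0 <= y ^+ 2 / 2 / expR (y ^+ 2 / 2) by rewrite divr_ge0// ltW.
  rewrite normrN ger0_norm; last exact: mulr_ge0.
  rewrite ler_piMr// ler_pdivrMr// mul1r.
  by rewrite (le_trans _ (expR_ge1Dx _))// lerDr.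
- exact: dPhi.
- exact: Phi0.
- exact: Phiy.
Qed.

(** * The grey Brownian density in self-similar form *)

Lemma fB_prefactor (R : realType) (alpha t : R) : 0 < t ->
  (Num.sqrt (2 * pi * t `^ alpha))^-1 =
  t `^ (- (alpha / 2)) * (Num.sqrt (2 * pi))^-1.
Proof.
move=> t0; rewrite sqrtrM ?mulr_ge0 ?pi_ge0// invfM mulrC powRN.
by rewrite -powR12_sqrt ?powR_ge0// -powRrM.
Qed.

Lemma fB_exponent (R : realType) (alpha x t tau : R) : 0 < t ->
  x ^+ 2 / (2 * tau * t `^ alpha) = (x * t `^ (- (alpha / 2))) ^+ 2 / 2 / tau.
Proof.
move=> t0; have -> : alpha = alpha / 2 + alpha / 2 by field.
rewrite powRD ?(gt_eqF t0) ?implybT// powRN.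
rewrite (_ : (alpha / 2 + alpha / 2) / 2 = alpha / 2); last by field.
rewrite !invfM exprMn exprVn expr2 invfM; ring.
Qed.

Lemma fB_gaussian (R : realType) (alpha x t : R) : 0 < t ->
  fB alpha 1 x t = t `^ (- (alpha / 2)) *
    ((Num.sqrt (2 * pi))^-1 * expR (- ((x * t `^ (- (alpha / 2))) ^+ 2 / 2))).
Proof.
move=> t0; rewrite /fB fB_prefactor// /lmix eqxx mulrA; congr (_ * _).
rewrite /Rintegral integral_dirac//; last first.
  apply/measurable_EFinP; apply: open_continuous_measurable_fun.
    exact: interval_open.
  move=> tau; rewrite inE/= in_itv/= andbT => tau0; apply: cvgM.
    exact: is_derive_continuous (is_derive1_powR _ tau0).
  under eq_fun do rewrite fB_exponent//.
  rewrite fB_exponent//.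
  exact: is_derive_continuous (expR_div_derive _ (lt0r_neq0 tau0)).
rewrite diracE mem_set ?mul1e/=; last by rewrite in_itv/= ltr01.
by rewrite powR1 mul1r fB_exponent// divr1.
Qed.

Lemma fB_mixture (R : realType) (alpha rho x t : R) : 0 < rho < 1 -> 0 < t ->
  fB alpha rho x t = t `^ (- (alpha / 2)) *
    ((Num.sqrt (2 * pi))^-1 * (Gamma rho * Gamma (1 - rho))^-1 *
     mixture (wmix rho) ((x * t `^ (- (alpha / 2))) ^+ 2 / 2)).
Proof.
move=> rho01 t0; rewrite /fB fB_prefactor// /lmix lt_eqF; last by case/andP: rho01.
rewrite -[LHS]mulrA -(mulrA (Num.sqrt _)^-1); congr (_ * (_ * _)).
rewrite /mixture -RintegralZl//; last 2 first.
- exact: measurable_ray1.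
- by apply: mixture_integrable; exact: weight_wmix.
rewrite Rintegral_mkcond [RHS]Rintegral_mkcond; congr Rintegral.
apply/funext => tau; rewrite !patchE /ray1 !mem_setE !in_itv/= !andbT.
(* [lrho] vanishes for tau <= 1, which reduces the integral over ]0, +oo[ to the ray. *)
have [tau1|tau1] := ltP 1 tau; last first.
  by case: ifP => // _; rewrite /lrho ltNge tau1/= mulr0.
rewrite (lt_trans ltr01 tau1) /lrho tau1 wmixE// fB_exponent//; ring.
Qed.

Theorem theorem5p3 (R : realType) (alpha rho : R)
    (rho_gt0 : 0 < rho) (rho_le1 : rho <= 1)
    (alpha_gt0 : 0 < alpha) (alpha_le1 : alpha <= 1) :
  [/\ terms_well_defined alpha (fB alpha rho),
      satisfies_equation alpha rho (fB alpha rho) (delta 0),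
      initial_datum (fB alpha rho) (delta 0) &
      vanishes_at_infinity (fB alpha rho)].
Proof.
(* The scaling form is asked for at t > 0 only: the equation, the integral over ]0, t[ and the limit
   at 0+ involve positive times alone. *)
suff [h [h1 [h2 [Phi [hP fE]]]]] : exists h h1 h2 Phi, profile rho h h1 h2 Phi /\
    forall x t, 0 < t ->
    fB alpha rho x t = t `^ (- (alpha / 2)) * h (x * t `^ (- (alpha / 2))).
  split.
  - exact: profile_terms_well_defined alpha_gt0 hP fE.
  - exact: profile_satisfies_equation alpha_gt0 hP fE.
  - exact: profile_initial_datum alpha_gt0 hP fE.
  - exact: profile_vanishes_at_infinity hP fE.
move: rho_le1; rewrite le_eqVlt => /predU1P[->|rho_lt1].
  have [h1 [h2 [Phi hP]]] := gaussian_profile R.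
  by do 4 eexists; split; [exact: hP|move=> x t; exact: fB_gaussian].
have rho01 : 0 < rho < 1 by rewrite rho_gt0.
have G0 : 0 < Gamma rho * Gamma (1 - rho).
  by rewrite mulr_gt0// Gamma_gt0 ?subr_gt0 ?gerBl// ltW.
have c0 : 0 < Num.sqrt (2 * pi : R) by rewrite sqrtr_gt0 mulr_gt0 ?pi_gt0.
have [||Phi hP] := @mixture_profile R rho
  ((Num.sqrt (2 * pi))^-1 * (Gamma rho * Gamma (1 - rho))^-1) rho01.
- by rewrite mulr_ge0// invr_ge0 ltW.
- by rewrite mulrACA (mulVf (lt0r_neq0 G0)) mulr1 mulKf// lt0r_neq0.
by do 4 eexists; split; [exact: hP|move=> x t; exact: fB_mixture].
Qed.
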